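(* Let $T>0$. Each state $W^T\in\widetilde H^0$ is approximately reachable from the origin in the time $T$, for the control system $W_t=W_{xx}-2u\delta'$, $x\in\mathbb R$, $t\in(0,T)$, $W(\cdot,0)=W^0$; that is, $W^T\in\overline{\mathcal R_T(0)}$ for every $W^T\in\widetilde H^0$, where the closure is taken in $\widetilde H^0$.
   Context: For $m=0,1,2$, $H^m$ is the Sobolev space of $\varphi\in L^2(\mathbb R)$ with $\varphi^{(k)}\in L^2(\mathbb R)$, $k\le m$; $H^{-m}=(H^m)^*$; $\widetilde H^{n}$ is the closed subspace of odd distributions in $H^{n}$, $n=-2,\dots,2$. In particular $\widetilde H^0$ is the space of odd functions in $L^2(\mathbb R)$ with the $L^2(\mathbb R)$ norm. States and controls are over one fixed scalar field. Control system: for $T>0$, an initial state $W^0\in\widetilde H^0$ and a control $u\in L^\infty(0,T)$ consider $$W_t=W_{xx}-2u(t)\delta',\quad x\in\mathbb R,\ t\in(0,T),\qquad W(\cdot,0)=W^0,$$ where $\delta$ is the Dirac distribution in $x$ and $\left(\frac{d}{dt}\right)^m W:[0,T]\to\widetilde H^{-2m}$, $m=0,1$. Its unique solution is given, for $t\in(0,T]$, by $$W(x,t)=\frac{e^{-\frac{x^2}{4t}}}{\sqrt{4\pi t}}*W^0(x)+\sqrt{\tfrac2\pi}\,x\int_0^t e^{-\frac{x^2}{4\xi}}\frac{u(t-\xi)}{(2\xi)^{3/2}}\,d\xi,$$ where $*$ is convolution in $x$. A state $W^T\in\widetilde H^0$ is reachable from $W^0$ in time $T$ if there is $u\in L^\infty(0,T)$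 such that there exists a unique solution $W$ of the system, and $W(\cdot,T)=W^T$. $\mathcal R_T(W^0)$ is the set of all states in $\widetilde H^0$ reachable from $W^0$ in time $T$; in particular $$\mathcal R_T(0)=\Big\{W^T\in\widetilde H^0 : \exists v\in L^\infty(0,T),\ W^T(x)=\sqrt{\tfrac{2}{\pi}}\,x\int_0^T e^{-\frac{x^2}{4\xi}}\frac{v(\xi)}{(2\xi)^{3/2}}\,d\xi\Big\}.$$ A state $W^T\in\widetilde H^0$ is approximately reachable from $W^0\in\widetilde H^0$ in time $T$ if $W^T\in\overline{\mathcal R_T(W^0)}$, with closure in $\widetilde H^0$; equivalently, for each $\varepsilon>0$ there is $u_\varepsilon\in L^\infty(0,T)$ such that the solution $W$ with $u=u_\varepsilon$ satisfies $\|W(\cdot,T)-W^T\|_{L^2(\mathbb R)}<\varepsilon$. *)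

(* Defs.v *)
(* Scalars are real. States are functions R -> R considered up to equality
   almost everywhere; a curve of states is W : R -> R -> R, with the time t as
   first argument and the space variable x as second. *)
From HB Require Import structures.
From mathcomp Require Import all_boot all_order all_algebra.
From mathcomp Require Import all_classical all_reals all_analysis.

Set Implicit Arguments.
Unset Strict Implicit.
Unset Printing Implicit Defensive.

Import Order.TTheory GRing.Theory Num.Theory.
Import numFieldNormedType.Exports.

Local Open Scope classical_set_scope.
Local Open Scope ring_scope.

Section heat_control_system.
Context {R : realType}.
Implicit Types (f g w u : R -> R) (W : R -> R -> R) (T : R).

Local Notation mu := (@lebesgue_measure R).

Definition L2 : set (R -> R) := [set f | f \in Lfun mu 2%:E].

Definition L2dist f g : \bar R := 'N[mu]_2%:E[EFin \o (f \- g)%R]%E.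

Definition Linfty T : set (R -> R) :=
  [set u | (u \_ `]0, T[) \in Lfun mu +oo%E].

Definition Htilde0 : set (R -> R) :=
  [set f | L2 f /\ (fun x => f (- x)) = (fun x => - f x) %[ae mu]].

(* f is absolutely continuous on [a, b] with f' = g almost everywhere. *)
Definition ac_derivative (a b : R) f g :=
  mu.-integrable `[a, b] (EFin \o g) /\
  forall x : R, x \in `[a, b] -> f x = f a + \int[mu]_(y in `[a, x]) g y.

(* H^2 on the line: an element is given by its C^1 representative, the
   continuous first derivative, and a representative of the second one. *)
Record H2 := MkH2 {
  H2_val :> R -> R ;
  H2_d1 : R -> R ;
  H2_d2 : R -> R ;
  H2_val_L2 : L2 H2_val ;
  H2_d1_L2 : L2 H2_d1 ;
  H2_d2_L2 : L2 H2_d2 ;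
  H2_val_d1 : forall a b : R, a <= b -> ac_derivative a b H2_val H2_d1 ;
  H2_d1_d2 : forall a b : R, a <= b -> ac_derivative a b H2_d1 H2_d2 }.

(* Elements of H^{-2} = (H^2)^*, as functionals on H2: the function w itself,
   its second distributional derivative, and the derivative of Dirac's delta
   at 0. All three vanish on even phi when w is odd. *)
Definition L2_to_Hm2 w (phi : H2) : R := \int[mu]_x (w x * phi x).
Definition dxx w (phi : H2) : R := \int[mu]_x (w x * H2_d2 phi x).
Definition delta' (phi : H2) : R := - H2_d1 phi 0.

(* W_t = W_xx - 2 u delta' on (0, T), W(., 0) = W0. As u is only in
   L^oo(0, T), W_t is the almost everywhere derivative of the absolutely
   continuous curve W in H^{-2}; the bound says that W is in
   L^oo(0, T; Htilde0), hence W_t in L^oo(0, T; H^{-2}). *)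
Definition solution T (W0 u : R -> R) W :=
  [/\ forall t : R, t \in `[0, T] -> Htilde0 (W t),
      exists M : R, forall t : R, t \in `[0, T] -> (L2dist (W t) (cst 0%R) <= M%:E)%E,
      W 0 = W0 %[ae mu] &
      forall phi : H2,
        ac_derivative 0 T (fun t => L2_to_Hm2 (W t) phi)
          (fun t => dxx (W t) phi - 2 * u t * delta' phi)].

Definition unique_solution T (W0 u : R -> R) W :=
  solution T W0 u W /\
  forall W', solution T W0 u W' ->
    forall t : R, t \in `[0, T] -> W' t = W t %[ae mu].

Definition reachable T (W0 : R -> R) : set (R -> R) :=
  [set WT | Htilde0 WT /\
    exists u, Linfty T u /\
      exists W, unique_solution T W0 u W /\ W T = WT %[ae mu]].

Definition Htilde0_closure (A : set (R -> R)) : set (R -> R) :=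
  [set f | Htilde0 f /\
    forall e : R, 0 < e -> exists2 g, A g & (L2dist g f < e%:E)%E].

Definition approximately_reachable T (W0 : R -> R) : set (R -> R) :=
  Htilde0_closure (reachable T W0).

End heat_control_system.

(* Main.v *)
(* Write [k_s x = 2 w^3 x exp (- w^2 x^2)] with [w = (2 sqrt s)^-1]; up to a
   constant this is the solution of the heat equation with initial datum
   [- delta'], so a constant control switched on at time [a] produces the
   state [x |-> \int_0^(t - a) k_s x ds], an odd profile of erfc type.
   Step controls thus reach these profiles for every duration in [0, T], and
   difference quotients in the duration put every [k_s] with [s <= T], that is
   every [x exp (- p x^2)] with [p >= (4 T)^-1], in the closure of the reachable
   set. So it contains [x exp (- p x^2) q (exp (- x^2))] for every polynomial
   [q], and these functions are dense among the odd ones: on the support of a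
   truncation, divide by [x exp (- p x^2)], approximate by a continuous
   function, and apply Weierstrass' theorem in the variable [z = exp (- x^2)].

   Reachability asks for uniqueness as well. If [V] is a solution with zero data,
   then [<V(t), k_(s - t)>] is constant in [t], hence zero; by the same density,
   [V(t) = 0]. *)
Require Import Defs.
From HB Require Import structures.
From mathcomp Require Import all_boot all_order all_algebra.
From mathcomp Require Import all_classical all_reals all_analysis.
From mathcomp Require Import measurable_realfun gauss_integral ring lra.

Import Order.TTheory GRing.Theory Num.Theory.
Import numFieldNormedType.Exports.

Set Implicit Arguments.
Unset Strict Implicit.
Unset Printing Implicit Defensive.

Local Open Scope classical_set_scope.
Local Open Scope ring_scope.

(** * Polynomial approximation *)

(** The limit [s <= T] restricts the exponents only from below, and multiplication by [expR (- x^2)]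
    raises them. Hence the Gaussians obtained in a short time, although they all decay fast, span a
    space stable under this multiplication; so no time is too short.

    For existence, the obstacle is that the step profile jumps at the origin, so the equation has to
    be checked against test functions. There the jump turns into a boundary term at 0, which is the
    [delta'] term, and the remainder is a pairing with [k_s], integrated in time by Fubini. The work
    is done on the half-line [x > 0], where all profiles are nonnegative.

    For uniqueness, a null solution is known only through its pairings with fixed test functions.
    Along the moving [k_(s - t)] the two variations cancel to first order and leave an error
    quadratic in the step; this takes both [k_s] and its second derivative as test functions.

    Linear combinations are formed with existence alone, and uniqueness is added once, at the end.
    The difference quotients use controls of size [1 / h]: each is bounded, with no common bound. *)

Section weierstrass.
Context {R : realType}.
Implicit Types (F G : nat -> R) (z : R).

(* The mean of [F] at a binomial variable of parameters [n] and [z], computed by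
   conditioning on one trial. *)
Fixpoint bernstein n F z : R :=
  if n is m.+1 then z * bernstein m (F \o succn) z + (1 - z) * bernstein m F z
  else F 0%N.

Lemma bernstein_poly n F :
  exists p : {poly R}, forall z, bernstein n F z = p.[z].
Proof.
elim: n F => [|n IHn] F; first by exists (F 0%N)%:P => z; rewrite hornerC.
have [p pE] := IHn (F \o succn); have [q qE] := IHn F.
by exists ('X * p + (1 - 'X) * q) => z /=; rewrite pE qE !hornerE.
Qed.

Lemma le_bernstein n F G z : 0 <= z <= 1 ->
  (forall k, (k <= n)%N -> F k <= G k) -> bernstein n F z <= bernstein n G z.
Proof.
move=> /andP[z0 z1]; elim: n F G => [|n IHn] F G FG /=; first exact: FG.
rewrite lerD// ler_wpM2l ?subr_ge0// IHn// => k kn; first by rewrite /= FG.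
by apply: FG; rewrite ltnW.
Qed.

Lemma bernstein_affine n F a b z :
  bernstein n (fun k => a + b * F k) z = a + b * bernstein n F z.
Proof.
elim: n F => [|n IHn] F //=.
by rewrite -[X in z * bernstein n X z]/(fun k => a + b * (F \o succn) k) !IHn; ring.
Qed.

(** Squared bias plus variance of a binomial variable. The centre [c] is arbitrary because
    conditioning on one successful trial shifts it to [c - 1]. *)
Lemma bernstein_sqr n c z :
  bernstein n (fun k => (k%:R - c) ^+ 2) z =
  (n%:R * z - c) ^+ 2 + n%:R * (z * (1 - z)).
Proof.
elim: n c => [|n IHn] c /=; first by rewrite !mul0r addr0.
have -> : (fun k : nat => (k%:R - c) ^+ 2) \o succn =
          (fun k => (k%:R - (c - 1)) ^+ 2).
  by apply/funext => k /=; rewrite -natr1; ring.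
by rewrite !IHn -natr1; ring.
Qed.

(** By contradiction: take pairs closer than [n.+1%:R^-1] whose values stay [e] apart. Along a
    subsequence the first components converge, the second ones follow to the same limit, and
    continuity there is violated. *)
Lemma uniformly_continuous01 (f : R -> R) (e : R) : continuous f -> 0 < e ->
  exists2 d : R, 0 < d & forall x y : R, 0 <= x <= 1 -> 0 <= y <= 1 ->
    `|x - y| < d -> `|f x - f y| < e.
Proof.
move=> cf e0; apply: contrapT => H.
have {}H (n : nat) : exists xy : R * R, [/\ 0 <= xy.1 <= 1, 0 <= xy.2 <= 1,
    `|xy.1 - xy.2| < n.+1%:R^-1 & e <= `|f xy.1 - f xy.2|].
  apply: contrapT => Hn; apply: H; exists n.+1%:R^-1; first by rewrite invr_gt0.
  move=> x y x01 y01 xy; rewrite ltNge; apply/negP => exy.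
  by apply: Hn; exists (x, y).
have [u uP] := choice H.
have [|g gi /cvg_ex[/= l gl]] := bolzano_weierstrass (u_ := fun n => (u n).1).
  exists 1; split => // M M1 n _ /=; have [/andP[? ?] _ _ _] := uP n.
  by rewrite ger0_norm// (le_trans _ (ltW M1)).
have gl2 : (u (g n)).2 @[n --> \oo] --> l.
  have -> : (fun n => (u (g n)).2) =
      (fun n => (u (g n)).1 - ((u (g n)).1 - (u (g n)).2)).
    by apply/funext => n; ring.
  rewrite -[l]subr0; apply: cvgB => //.
  apply/norm_cvg0P; apply: (squeeze_cvgr _ (cvg_cst 0) (@cvg_harmonic R)).
  near=> n; rewrite normr_ge0/=; have [_ _ /ltW + _] := uP (g n).
  move=> /le_trans; apply; rewrite lef_pV2 ?posrE// ler_nat ltnS.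
  (* A strictly increasing [g] satisfies [n <= g n]. *)
  elim: (n) => // m IHm; rewrite (leq_ltn_trans IHm)//.
  by rewrite ltnNge; apply/negP => gm; have := gi m.+1 m; rewrite !leEnat gm ltnn.
have : f (u (g n)).1 - f (u (g n)).2 @[n --> \oo] --> f l - f l.
  by apply: cvgB; apply: (continuous_cvg _ (cf _)).
rewrite subrr => /cvgr0_norm_lt/(_ _ e0)[N _ /(_ N (leqnn _))/=].
by have [_ _ _] := uP (g N); rewrite leNgt => /negP.
Unshelve. all: by end_near. Qed.

(** Bernstein's proof with Chebyshev's inequality: if [k / n] is within [d] of [z], uniform
    continuity gives [e / 2]; otherwise [2 * M] is at most [2 * M] times the square of
    [|k / n - z| / d]. The mean of the sum of both bounds is computed by [bernstein_sqr]. *)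
Lemma weierstrass (f : R -> R) (e : R) : continuous f -> 0 < e ->
  exists p : {poly R}, forall z, 0 <= z <= 1 -> `|f z - p.[z]| <= e.
Proof.
move=> cf e0.
have e20 : 0 < e / 2 by rewrite divr_gt0.
have [d d0 dP] := uniformly_continuous01 cf e20.
have [M M0 MP] : exists2 M : R, 0 < M & forall z, 0 <= z <= 1 -> `|f z| <= M.
  have /compact_bounded[M [_ mrt]] : compact (f @` `[0, 1]).
    by apply: continuous_compact; [exact: continuous_subspaceT|exact: segment_compact].
  exists (`|M| + 1) => [|z z01]; first by rewrite ltr_wpDl.
  apply: mrt; first by rewrite (le_lt_trans (ler_norm _))// ltrDl.
  by exists z => //=; rewrite in_itv.
(* This threshold makes the variance term at most [b * n%:R = e / 2 * (B / n%:R)], hence at most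
   [e / 2] once [n] exceeds [B]. *)
pose B := 4 * M / (d ^+ 2 * e).
have B0 : 0 < B by rewrite divr_gt0 ?mulr_gt0// exprn_gt0.
pose n := (Num.truncn B).+1.
have nB : B < n%:R by rewrite truncnS_gt.
have n0 : 0 < n%:R :> R by rewrite (lt_trans B0).
pose F (k : nat) := f (k%:R / n%:R).
have [p pE] := bernstein_poly n F.
exists p => z z01; rewrite -pE.
have kn k : (k <= n)%N -> 0 <= (k%:R / n%:R : R) <= 1.
  by move=> kn; rewrite divr_ge0// ler_pdivrMr// mul1r ler_nat.
pose b := 2 * M / (d ^+ 2 * n%:R ^+ 2).
have b0 : 0 <= b by rewrite divr_ge0 ?mulr_ge0 ?exprn_ge0// ltW.
have Fz k : (k <= n)%N ->
    `|F k - f z| <= e / 2 + b * (k%:R - n%:R * z) ^+ 2.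
  move=> /kn kn01; have [kz|kz] := ltP `|k%:R / n%:R - z| d.
    by rewrite (le_trans (ltW (dP _ _ _ _ kz)))// lerDl mulr_ge0// sqr_ge0.
  rewrite (@le_trans _ _ (2 * M))//.
    by rewrite (le_trans (ler_normB _ _))// mulrDl mul1r lerD// MP.
  rewrite (@le_trans _ _ (b * (k%:R - n%:R * z) ^+ 2))//; last first.
    by rewrite lerDr ltW.
  have -> : k%:R - n%:R * z = n%:R * (k%:R / n%:R - z).
    by field; rewrite gt_eqF.
  have -> : b * (n%:R * (k%:R / n%:R - z)) ^+ 2 =
            2 * M * (`|k%:R / n%:R - z| / d) ^+ 2.
    rewrite expr_div_n real_normK ?num_real// /b.
    by field; rewrite !gt_eqF.
  rewrite ler_peMr ?mulr_ge0 ?(ltW M0)// -[leLHS](expr1n _ 2).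
  by rewrite ler_pXn2r// ?nnegrE ?divr_ge0 ?(ltW d0)// ler_pdivlMr// mul1r.
have bn : b * (n%:R * (z * (1 - z))) <= e / 2.
  have zz : z * (1 - z) <= 1 by have/andP[? ?] := z01; nra.
  rewrite (@le_trans _ _ (b * n%:R))//.
    by rewrite ler_wpM2l// ler_piMr// ltW.
  have -> : b * n%:R = (e / 2) * (B / n%:R).
    by rewrite /b /B; field; rewrite !gt_eqF.
  by rewrite ler_piMr ?(ltW e20)// ler_pdivrMr// mul1r ltW.
have Fl k : (k <= n)%N -> F k <= (f z + e / 2) + b * (k%:R - n%:R * z) ^+ 2.
  by move=> /Fz; rewrite ler_norml => /andP[_]; lra.
have Fg k : (k <= n)%N -> (f z - e / 2) + (- b) * (k%:R - n%:R * z) ^+ 2 <= F k.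
  by move=> /Fz; rewrite ler_norml => /andP[+ _]; lra.
have := le_bernstein z01 Fl; have := le_bernstein z01 Fg.
rewrite !bernstein_affine bernstein_sqr subrr expr0n/= add0r.
by move=> h1 h2; rewrite ler_norml; apply/andP; split; lra.
Qed.

End weierstrass.

(** * Preliminaries of calculus and L2 theory *)

Section calculus.
Context {R : realType}.

(** Apply [y ^+ m / m! <= expR y] at [y = p * (1 + x ^+ 2)]; the factor [expR p] pays for the
    summand 1. *)
Lemma gauss_bound m (p x : R) : 0 < p ->
  (1 + x ^+ 2) ^+ m * expR (- (p * x ^+ 2)) <= expR p * m`!%:R / p ^+ m.
Proof.
move=> p0.
have y0 : 0 <= p * (1 + x ^+ 2) by rewrite mulr_ge0 ?addr_ge0 ?sqr_ge0// ltW.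
have H : (p * (1 + x ^+ 2)) ^+ m / m`!%:R <= expR (p * (1 + x ^+ 2)).
  case: m => [|m].
    by rewrite expr0 fact0 divr1 (le_trans _ (expR_ge1Dx _))// lerDl.
  by rewrite (le_trans _ (expR_ge1Dxn m y0))// lerDr.
rewrite expRN ler_pdivrMr ?expR_gt0// [leRHS]mulrAC ler_pdivlMr ?exprn_gt0//.
rewrite -exprMn mulrC mulrAC -expRD.
rewrite ler_pdivrMr ?ltr0n ?fact_gt0// in H.
by rewrite (le_trans H)// ler_wpM2r// mulrDr mulr1.
Qed.

(** Two uses of the mean value theorem, which ask no continuity of [f2] and give [C] in place of
    [C / 2]. The expansion at [a] serves uniqueness, the one at [b] the difference quotients. *)
Lemma taylor2 (f f1 f2 : R -> R) (a b C : R) : a <= b ->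
  (forall x, a <= x <= b -> is_derive x 1 f (f1 x)) ->
  (forall x, a <= x <= b -> is_derive x 1 f1 (f2 x)) ->
  (forall x, a <= x <= b -> `|f2 x| <= C) ->
  `|f b - f a - (b - a) * f1 a| <= C * (b - a) ^+ 2 /\
  `|f b - f a - (b - a) * f1 b| <= C * (b - a) ^+ 2.
Proof.
rewrite le_eqVlt => /predU1P[<- _ _ _|ab f1P f2P fC].
  by rewrite !subrr mul0r subrr normr0 expr0n/= mulr0.
have C0 : 0 <= C by rewrite (le_trans _ (fC a _)) ?lexx// ltW.
have mvt (g g' : R -> R) u v : a <= u -> u < v -> v <= b ->
    (forall x, a <= x <= b -> is_derive x 1 g (g' x)) ->
    exists c, [/\ u < c, c < v & g v - g u = g' c * (v - u)].
  move=> au uv vb gP.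
  have gP' x : u <= x <= v -> is_derive x 1 g (g' x).
    by move=> /andP[ux xv]; apply: gP; rewrite (le_trans au)//= (le_trans xv).
  have [x| |c] := @MVT _ g g' u v uv.
  - by rewrite in_itv/= => /andP[/ltW ? /ltW ?]; apply: gP'; apply/andP.
  - apply: derivable_within_continuous => x.
    by rewrite in_itv/= => /gP'[].
  - by rewrite in_itv/= => /andP[? ?] ?; exists c.
have [c [ac cb ->]] := mvt _ _ _ _ (lexx _) ab (lexx _) f1P.
have [d [ad dc E]] := mvt _ _ _ _ (lexx _) ac (ltW cb) f2P.
have [d' [cd' d'b E']] := mvt _ _ _ _ (ltW ac) cb (lexx _) f2P.
have ba0 : 0 <= b - a by rewrite subr_ge0 ltW.
rewrite !(mulrC (b - a)) -!mulrBl !normrM (ger0_norm ba0) (expr2 (b - a)) mulrA.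
have fd : `|f2 d| <= C by rewrite fC// ltW//= (le_trans (ltW dc))// ltW.
have fd' : `|f2 d'| <= C by rewrite fC// (le_trans (ltW ac)) ?(ltW cd')//= ltW.
split; rewrite ler_wpM2r//.
  by rewrite E normrM ler_pM// ger0_norm ?subr_ge0 ?lerD2r// ltW.
by rewrite -opprB normrN E' normrM ler_pM// ger0_norm ?subr_ge0 ?lerD2l ?lerN2// ltW.
Qed.

(** Over [n.+1] equal pieces the increments add up to at most [C * (b - a) ^+ 2 / n.+1%:R], which
    tends to 0. This replaces a vanishing derivative when [g] is not known to be differentiable. *)
Lemma quadratic_increments_cst (g : R -> R) (a b C : R) : a <= b ->
  (forall x y, a <= x -> x <= y -> y <= b -> `|g y - g x| <= C * (y - x) ^+ 2) ->
  g b = g a.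
Proof.
move=> ab gC; apply/eqP; rewrite -subr_eq0 -normr_le0.
have step (n m : nat) : (m <= n.+1)%N ->
    `|g (a + m%:R * ((b - a) / n.+1%:R)) - g a| <=
    m%:R * (C * ((b - a) / n.+1%:R) ^+ 2).
  set h := (b - a) / n.+1%:R.
  have h0 : 0 <= h by rewrite divr_ge0 ?subr_ge0.
  elim: m => [|m IHm] mn; first by rewrite !mul0r addr0 subrr normr0.
  have mS : m.+1%:R = m%:R + 1 :> R by rewrite natr1.
  rewrite -(subrK (g (a + m%:R * h)) (g (a + m.+1%:R * h))) -addrA.
  rewrite (le_trans (ler_normD _ _))//.
  rewrite [leRHS](_ : _ = C * h ^+ 2 + m%:R * (C * h ^+ 2)); last by rewrite mS; ring.
  rewrite lerD ?IHm 1?ltnW//.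
  apply: (le_trans (gC _ _ _ _ _)).
  - by rewrite lerDl mulr_ge0.
  - by rewrite lerD2l ler_wpM2r// ler_nat.
  - rewrite -lerBrDl mulrA ler_pdivrMr// mulrC ler_wpM2l ?subr_ge0//.
    by rewrite ler_nat.
  - by rewrite le_eqVlt mS; apply/orP; left; apply/eqP; ring.
have {}step (n : nat) : `|g b - g a| <= C * (b - a) ^+ 2 / n.+1%:R.
  have := step n n.+1 (leqnn _).
  have : n.+1%:R != 0 :> R by rewrite pnatr_eq0.
  move: (n.+1%:R) => N N0.
  have -> : a + N * ((b - a) / N) = b by field.
  by have -> : N * (C * ((b - a) / N) ^+ 2) = C * (b - a) ^+ 2 / N by field.
have : C * (b - a) ^+ 2 / n.+1%:R @[n --> \oo] --> C * (b - a) ^+ 2 * 0.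
  by apply: cvgM; [exact: cvg_cst|exact: cvg_harmonic].
rewrite mulr0 => /(ler_cvg_to (cvg_cst `|g b - g a|)); apply.
by apply: nearW => n; exact: step.
Qed.

Lemma is_derive_continuous (f f' : R -> R) :
  (forall x : R, is_derive x 1 f (f' x)) -> continuous f.
Proof.
by move=> df x; apply/differentiable_continuous/derivable1_diffP; have [] := df x.
Qed.

Lemma is_derive_gauss (p x : R) :
  is_derive x 1 (fun x : R => expR (- (p * x ^+ 2))) (- (2 * p * x) * expR (- (p * x ^+ 2))).
Proof.
have H : is_derive x 1 (fun x : R => - (p * x ^+ 2)) (- (2 * p * x)).
  by apply: is_derive_eq; rewrite /GRing.scale /=; ring.
have := @is_derive1_comp R expR (fun x : R => - (p * x ^+ 2)) x _ _ (is_derive_expR _) H.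
by rewrite mulrC.
Qed.

Lemma continuous_gauss (p : R) : continuous (fun x : R => expR (- (p * x ^+ 2))).
Proof. exact: is_derive_continuous (is_derive_gauss p). Qed.

(** The inverse is discontinuous at 0; writing it as [x] times a real power of [x ^+ 2] gives a
    product of measurable functions with the right value 0 at 0. *)
Lemma measurable_invr : measurable_fun setT (@GRing.inv R).
Proof.
have -> : @GRing.inv R = (fun x : R => x * (x ^+ 2) `^ (-1)).
  apply/funext => x; rewrite powR_inv1 ?sqr_ge0//.
  by have [->|x0] := eqVneq x 0; [rewrite invr0 mul0r|field].
apply: measurable_funM => //; apply: (measurableT_comp (measurable_powR _)).
by apply: continuous_measurable_fun; exact: exprn_continuous.
Qed.

End calculus.

Section ae_lebesgue.
Context {R : realType}.
Notation mu := (@lebesgue_measure R).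
Implicit Types P Q S : set R.

Lemma ae_impl P Q : (forall x, P x -> Q x) ->
  {ae mu, forall x, P x} -> {ae mu, forall x, Q x}.
Proof. exact: (@filterS _ _ (ae_filter_ringOfSetsType mu)). Qed.

Lemma ae_impl2 P Q S : (forall x, P x -> Q x -> S x) ->
  {ae mu, forall x, P x} -> {ae mu, forall x, Q x} -> {ae mu, forall x, S x}.
Proof. exact: (@filterS2 _ _ (ae_filter_ringOfSetsType mu)). Qed.

Lemma eq_ae (f g : R -> R) : f =1 g -> f = g %[ae mu].
Proof. by move=> fg; apply: aeW => x _; exact: fg. Qed.

End ae_lebesgue.

Section L2_norm.
Context {R : realType}.
Notation mu := (@lebesgue_measure R).
Implicit Types f g : R -> R.

(** [fine] sends an infinite norm to 0, so an upper bound on [L2norm f] has content only together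
    with [L2 f]. *)
Definition L2norm f : R := fine ('N[mu]_2%:E[EFin \o f])%E.

Lemma L2_measurable f : L2 f -> measurable_fun setT f.
Proof. by rewrite /L2/= inE => /andP[]; rewrite inE. Qed.

Lemma L2_fin_num f : L2 f -> 'N[mu]_2%:E[EFin \o f]%E \is a fin_num.
Proof.
rewrite /L2/= inE => /andP[_]; rewrite inE /finite_norm => h.
by rewrite ge0_fin_numE ?Lnorm_ge0.
Qed.

Lemma L2norm_EFin f : L2 f -> (L2norm f)%:E = 'N[mu]_2%:E[EFin \o f]%E.
Proof. by move=> /L2_fin_num fL; rewrite /L2norm fineK. Qed.

Lemma L2norm_ge0 f : 0 <= L2norm f.
Proof. by rewrite fine_ge0// Lnorm_ge0. Qed.

Lemma L2norm_sqr f : L2 f -> (L2norm f ^+ 2)%:E = (\int[mu]_x (f x ^+ 2)%:E)%E.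
Proof.
move=> fL; have n2 : 2 != 0 :> R by rewrite pnatr_eq0.
have := poweR_Lnorm mu (EFin \o f) n2.
rewrite -L2norm_EFin// poweR_EFin powR_mulrn ?L2norm_ge0// => ->.
apply: eq_integral => x _ /=.
by rewrite powR_mulrn ?normr_ge0// real_normK ?num_real.
Qed.

Lemma L2_intro f : measurable_fun setT f ->
  (\int[mu]_x (f x ^+ 2)%:E < +oo)%E -> L2 f.
Proof.
move=> mf foo; rewrite /L2/= inE; apply/andP; split; rewrite inE// /finite_norm.
have n2 : 2 != 0 :> R by rewrite pnatr_eq0.
apply: (@lty_poweRy _ _ 2) => //; rewrite poweR_Lnorm//.
apply: le_lt_trans foo; rewrite le_eqVlt; apply/orP; left; apply/eqP.
apply: eq_integral => x _ /=.
by rewrite powR_mulrn ?normr_ge0// real_normK ?num_real.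
Qed.

Let le12 : (1 <= 2%:E :> \bar R)%E. Proof. by rewrite lee_fin ler1n. Qed.

Lemma L2D f g : L2 f -> L2 g -> L2 (f \+ g).
Proof. by move=> fL gL; have := (Lfun_addr_closed mu le12).2 f g fL gL. Qed.

Lemma L2Z (c : R) f : L2 f -> L2 (fun x => c * f x).
Proof.
move=> fL; have := Lfun_scale c (ler1n R 2) fL.
by have -> // : c \o* f = (fun x => c * f x) by apply/funext => x /=; rewrite mulrC.
Qed.

Lemma L2N f : L2 f -> L2 (\- f).
Proof.
move=> fL; rewrite (_ : \- f = fun x => -1 * f x); first exact: L2Z.
by apply/funext => x; rewrite mulN1r.
Qed.

Lemma L2B f g : L2 f -> L2 g -> L2 (f \- g).
Proof. by move=> fL gL; exact: (L2D fL (L2N gL)). Qed.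

Lemma L2_0 : L2 (cst 0 : R -> R).
Proof. exact: (Lfun_addr_closed mu le12).1. Qed.

Lemma L2norm_le f (c : R) : L2 f -> 0 <= c ->
  (\int[mu]_x (f x ^+ 2)%:E <= (c ^+ 2)%:E)%E -> L2norm f <= c.
Proof.
move=> fL c0; rewrite -L2norm_sqr// lee_fin => h.
by rewrite -(@ler_pXn2r _ 2)// nnegrE// L2norm_ge0.
Qed.

Lemma L2normD f g : L2 f -> L2 g -> L2norm (f \+ g) <= L2norm f + L2norm g.
Proof.
move=> fL gL; rewrite -lee_fin EFinD !L2norm_EFin//; last exact: L2D.
exact: (@eminkowski _ _ _ mu f g _ (L2_measurable fL) (L2_measurable gL) le12).
Qed.

Lemma L2normZ (c : R) f : L2 f -> L2norm (fun x => c * f x) = `|c| * L2norm f.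
Proof.
move=> fL; apply/eqP; rewrite -(@eqrXn2 _ 2)// ?mulr_ge0 ?L2norm_ge0//.
apply/eqP; apply: EFin_inj; rewrite L2norm_sqr//; last exact: L2Z.
rewrite exprMn EFinM L2norm_sqr// real_normK ?num_real// -integralZl//.
  by apply: eq_integral => x _; rewrite -EFinM exprMn.
exact: Lfun2_integrable_sqr.
Qed.

Lemma L2normN f : L2 f -> L2norm (\- f) = L2norm f.
Proof.
move=> fL; have := L2normZ (-1) fL; rewrite normrN normr1 mul1r => <-.
by congr L2norm; apply/funext => x; rewrite mulN1r.
Qed.

Lemma L2_dominated f g : measurable_fun setT f -> L2 g ->
  (forall x, `|f x| <= `|g x|) -> L2 f /\ L2norm f <= L2norm g.
Proof.
move=> mf gL fg.
have I : (\int[mu]_x (f x ^+ 2)%:E <= \int[mu]_x (g x ^+ 2)%:E)%E.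
  apply: ge0_le_integral => //.
  - by move=> x _; rewrite lee_fin sqr_ge0.
  - by apply/measurable_EFinP; exact: measurable_funX.
  - by apply/measurable_EFinP/measurable_funX; exact: L2_measurable.
  - move=> x _; rewrite lee_fin -(real_normK (num_real (f x))).
    by rewrite -(real_normK (num_real (g x))) ler_pXn2r// nnegrE.
have fL : L2 f.
  by apply: L2_intro => //; rewrite (le_lt_trans I)// -L2norm_sqr// ltry.
by split => //; apply: L2norm_le => //; rewrite ?L2norm_ge0// L2norm_sqr.
Qed.

Lemma L2_integrableM f g : L2 f -> L2 g ->
  mu.-integrable setT (EFin \o (fun x => f x * g x)).
Proof. by move=> fL gL; apply/Lfun1_integrable; exact: Lfun2_mul_Lfun1. Qed.

Lemma cauchy_schwarz f g : L2 f -> L2 g ->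
  `|\int[mu]_x (f x * g x)| <= L2norm f * L2norm g.
Proof.
move=> fL gL; rewrite -lee_fin EFin_normr_Rintegral//; last exact: L2_integrableM.
apply: (le_trans (le_abse_integral _ _ _)) => //.
  exact: (measurable_int _ (L2_integrableM fL gL)).
rewrite EFinM !L2norm_EFin//.
have := @hoelder _ _ _ mu f g 2 2 (L2_measurable fL) (L2_measurable gL).
by rewrite Lnorm1; apply => //; rewrite [RHS]splitr !div1r.
Qed.

Lemma L2norm0_ae f : L2 f -> L2norm f = 0 -> f = cst 0 %[ae mu].
Proof.
move=> fL f0; have : ('N[mu]_2%:E[EFin \o f] = 0)%E by rewrite -L2norm_EFin// f0.
move=> /Lnorm_eq0_eq0; have /measurable_EFinP mf := L2_measurable fL.
by move=> /(_ mf (lt_le_trans lte01 le12)); apply: ae_impl => x /(_ I) [] -> _.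
Qed.

Lemma L2distE f g : L2 f -> L2 g -> L2dist f g = (L2norm (f \- g))%:E.
Proof. by move=> fL gL; rewrite L2norm_EFin//; exact: L2B. Qed.

End L2_norm.

(** * Reflection of the line and integrals over the half-line *)

Section reflection.
Context {R : realType}.
Notation mu := (@lebesgue_measure R).

Let mopp : measurable_fun setT (-%R : measurableTypeR R -> measurableTypeR R).
Proof. by apply: continuous_measurable_fun; exact: opp_continuous. Qed.

Lemma measurable_comp_opp (d : measure_display) (U : measurableType d) (u : R -> U) :
  measurable_fun setT u -> measurable_fun setT (fun x : R => u (- x)).
Proof. by move=> mu_; exact: (measurableT_comp mu_ mopp). Qed.

(** The image of [mu] under negation agrees with [mu] on the intervals []a, b]], and these determine
    Lebesgue measure. *)
Lemma lebesgue_measure_opp (A : set R) : measurable A ->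
  mu ((-%R : R -> R) @^-1` A) = mu A.
Proof.
move=> mA; pose nu : {measure set (measurableTypeR R) -> \bar R} :=
  measure_function_pushforward__canonical__measure_function_Measure mu mopp.
suff H X : ocitv X -> mu X = nu X by rewrite (lebesgue_measure_unique H mA).
move=> [[a b] _ <-] /=; rewrite /nu /= /pushforward.
have -> : (-%R : R -> R) @^-1` `]a, b] = `[(- b), (- a)[%classic.
  by apply/seteqP; split => x /=; rewrite !in_itv/=; lra.
rewrite [LHS](_ : _ = mu `]a, b]%classic)// !lebesgue_measure_itv/= !lte_fin ltrN2.
by case: ifP => // _; rewrite -!EFinD opprK addrC.
Qed.

Lemma ge0_integral_opp (f : R -> \bar R) : measurable_fun setT f ->
  (forall x, 0 <= f x)%E -> (\int[mu]_x f (- (x : R))%R = \int[mu]_x f x)%E.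
Proof.
move=> mf f0.
have := @ge0_integral_pushforward _ _ _ _ R _ mopp mu setT f measurableT mf.
rewrite preimage_setT => <-; last by move=> x _; exact: f0.
by apply: eq_measure_integral => A mA _; exact: lebesgue_measure_opp.
Qed.

Lemma integral_opp (f : R -> \bar R) : measurable_fun setT f ->
  (\int[mu]_x f (- (x : R))%R = \int[mu]_x f x)%E.
Proof.
move=> mf; rewrite integralE [RHS]integralE; congr (_ - _)%E.
  rewrite -(ge0_integral_opp (measurable_funepos mf) (fun x => funepos_ge0 f x)).
  by apply: eq_integral => x _; rewrite !funeposE.
rewrite -(ge0_integral_opp (measurable_funeneg mf) (fun x => funeneg_ge0 f x)).
by apply: eq_integral => x _; rewrite !funenegE.
Qed.

Lemma integral_half (f : R -> \bar R) : measurable_fun setT f ->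
  (\int[mu]_x f x = \int[mu]_(x in `[0%R, +oo[) f x +
                    \int[mu]_(x in `[0%R, +oo[) f (- (x : R))%R)%E.
Proof.
move=> mf.
have U : [set: R] = `[0%R, +oo[%classic `|` `]-oo, 0%R[%classic.
  by apply/seteqP; split => x //= _; rewrite !in_itv/= andbT; case: ltP; [right|left].
rewrite {1}U integral_setU//=; last 2 first.
- by rewrite -U.
- by apply/disj_setPS => x /=; rewrite !in_itv/= andbT => -[]; rewrite leNgt => /negP.
congr (_ + _)%E.
rewrite integral_mkcond -integral_opp; last first.
  by apply/measurable_restrict => //; apply: measurable_funTS.
rewrite -integral_itv_obnd_cbnd; last first.
  by apply: measurable_funTS; apply: measurableT_comp.
rewrite [RHS]integral_mkcond; apply: eq_integral => x _.
rewrite !patchE.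
have -> : (- x \in `]-oo, 0%R[%classic) = (x \in `]0%R, +oo[%classic) => //.
by apply/idP/idP; rewrite !inE/= !in_itv/= andbT; lra.
Qed.

Lemma integral_half_open (f : R -> \bar R) : measurable_fun setT f ->
  (\int[mu]_x f x = \int[mu]_(x in `]0%R, +oo[) f x +
                    \int[mu]_(x in `]0%R, +oo[) f (- (x : R))%R)%E.
Proof.
move=> mf; rewrite integral_half//; congr (_ + _)%E.
  by rewrite integral_itv_obnd_cbnd//; exact: measurable_funTS.
by rewrite integral_itv_obnd_cbnd//; apply: measurable_funTS; exact: measurable_comp_opp.
Qed.

Lemma integrable_comp_opp (f : R -> \bar R) : mu.-integrable setT f ->
  mu.-integrable setT (fun x : R => f (- x)).
Proof.
move=> /integrableP[mf foo]; apply/integrableP; split.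
  exact: measurable_comp_opp.
rewrite (@ge0_integral_opp (fun x => `|f x|%E))//.
exact: measurableT_comp.
Qed.

Lemma L2_comp_opp (f : R -> R) : L2 f -> L2 (fun x => f (- x)).
Proof.
move=> fL; have mf := L2_measurable fL.
apply: L2_intro; first exact: measurable_comp_opp.
rewrite (@ge0_integral_opp (fun x => (f x ^+ 2)%:E)).
- by rewrite -L2norm_sqr// ltry.
- by apply/measurable_EFinP; exact: measurable_funX.
- by move=> x; rewrite lee_fin sqr_ge0.
Qed.

End reflection.

(** * Square integrability by comparison with Gaussians *)

Section gaussian_L2.
Context {R : realType}.
Notation mu := (@lebesgue_measure R).

Lemma integral_oneDsqrV_lty :
  (\int[mu]_x ((1 + x ^+ 2)^-1 : R)%:E < +oo)%E.
Proof.
rewrite ge0_symfun_integralT; last 3 first.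
- by move=> x; rewrite invr_ge0 addr_ge0// sqr_ge0.
- exact: continuous_oneDsqrV.
- by move=> x /=; rewrite sqrrN.
rewrite (_ : [set x | _] = `[0, +oo[%classic).
  have -> := @integral0y_oneDsqr R.
  by rewrite -EFinM ltry.
by apply/seteqP; split => x/=; rewrite in_itv/= andbT.
Qed.

Lemma measurable_oneDsqrV : measurable_fun setT (fun x : R => (1 + x ^+ 2)^-1).
Proof. by apply: continuous_measurable_fun; exact: continuous_oneDsqrV. Qed.

Lemma L2_oneDsqrV : L2 (fun x : R => (1 + x ^+ 2)^-1).
Proof.
apply: L2_intro; first exact: measurable_oneDsqrV.
apply: le_lt_trans integral_oneDsqrV_lty.
apply: ge0_le_integral => //.
- by move=> x _; rewrite lee_fin sqr_ge0.
- by apply/measurable_EFinP/measurable_funX; exact: measurable_oneDsqrV.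
- by apply/measurable_EFinP; exact: measurable_oneDsqrV.
- move=> x _; rewrite lee_fin expr2 ler_piMl// ?invr_ge0 ?addr_ge0 ?sqr_ge0//.
  by rewrite invf_le1 ?lerDl ?sqr_ge0// ltr_pwDl// sqr_ge0.
Qed.

(** The Gaussian absorbs one further power of [1 + x ^+ 2], whence [m.+1] in [B], and leaves the
    square integrable [(1 + x ^+ 2)^-1]. As [K] is chosen before [C] and [f], one constant serves a
    whole family of functions, for instance all times in an interval. *)
Lemma L2_gauss_dominated m (p : R) : 0 < p -> exists2 K : R, 0 <= K &
  forall (C : R) (f : R -> R), measurable_fun setT f ->
    (forall x, `|f x| <= C * ((1 + x ^+ 2) ^+ m * expR (- (p * x ^+ 2)))) ->
    L2 f /\ L2norm f <= C * K.
Proof.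
move=> p0; set B := expR p * m.+1`!%:R / p ^+ m.+1.
have B0 : 0 <= B by rewrite divr_ge0 ?exprn_ge0 ?(ltW p0)// mulr_ge0 ?expR_ge0.
exists (B * L2norm (fun x : R => (1 + x ^+ 2)^-1)) => [|C f mf fC].
  by rewrite mulr_ge0// L2norm_ge0.
have C0 : 0 <= C.
  have := le_trans (normr_ge0 _) (fC 0).
  by rewrite expr0n/= mulr0 oppr0 expR0 addr0 expr1n !mulr1.
have [|fL fN] := L2_dominated mf (L2Z (C * B) L2_oneDsqrV).
  move=> x; rewrite (le_trans (fC x))// [leRHS]ger0_norm; last first.
    by apply: mulr_ge0; [exact: mulr_ge0|rewrite invr_ge0 addr_ge0 ?sqr_ge0].
  rewrite -mulrA ler_wpM2l// ler_pdivlMr ?ltr_pwDl ?sqr_ge0// mulrAC -exprSr.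
  exact: gauss_bound.
split => //; apply: (le_trans fN); rewrite L2normZ; last exact: L2_oneDsqrV.
by rewrite (ger0_norm (mulr_ge0 C0 B0)) mulrA.
Qed.

End gaussian_L2.

(** * Density of odd polynomial-Gaussian functions *)

Section density.
Context {R : realType}.
Notation mu := (@lebesgue_measure R).

(** The condition [|f x| <= N * |x|] keeps the truncation divisible by [x] with a bounded quotient;
    [|x| <= N] gives bounded support. Convergence is by dominated convergence with majorant
    [f ^+ 2]. *)
Lemma L2_truncation (f : R -> R) (e : R) : L2 f -> 0 < e ->
  exists N : nat,
  let g := fun x => if (`|f x| <= N%:R * `|x|) && (`|x| <= N%:R) then f x else 0 in
  [/\ (0 < N)%N, L2 g & L2norm (f \- g) <= e].
Proof.
move=> fL e0; have mf := L2_measurable fL.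
pose g (n : nat) x := if (`|f x| <= n%:R * `|x|) && (`|x| <= n%:R) then f x else 0.
have mg n : measurable_fun setT (g n).
  apply: measurable_fun_ifT => //.
  apply: measurable_and; apply: measurable_fun_ler => //.
  - exact: measurableT_comp.
  - by apply: measurable_funM => //; exact: measurableT_comp.
have gL n : L2 (g n).
  have [] := @L2_dominated R (g n) f => // x.
  by rewrite /g; case: ifP => // _; rewrite normr0.
have cvg0 : (\int[mu]_x ((f x - g n x) ^+ 2)%:E @[n --> \oo] --> 0)%E.
  have [| | | | |_ _] := @dominated_convergence _ _ _ mu setT measurableT
    (fun n x => ((f x - g n x) ^+ 2)%:E) (cst 0%E) (fun x => (f x ^+ 2)%:E).
  - move=> n; apply/measurable_EFinP; apply: measurable_funX.
    exact: (L2_measurable (L2B fL (gL n))).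
  - exact: measurable_cst.
  - exists ([set 0] : set R); split; [exact: measurable_set1|exact: lebesgue_measure_set1|].
    move=> x /= H; apply: contrapT => /eqP x0; apply: H => _.
    apply: cvg_near_cst; near=> n.
    rewrite /g ifT ?subrr ?expr0n//; apply/andP; split; last first.
      by near: n; exact: nbhs_infty_ger.
    rewrite -ler_pdivrMr ?normr_gt0//.
    by near: n; exact: nbhs_infty_ger.
  - exact: Lfun2_integrable_sqr.
  - apply: aeW => x n _; rewrite lee_fin ger0_norm ?sqr_ge0// /g.
    by case: ifP => _; rewrite ?subrr ?expr0n ?subr0//= sqr_ge0.
  - by rewrite integral_cst// mul0e.
have {}cvg0 : L2norm (f \- g n) ^+ 2 @[n --> \oo] --> (0 : R).
  have -> : (fun n => L2norm (f \- g n) ^+ 2) =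
      fine \o (fun n => (\int[mu]_x ((f x - g n x) ^+ 2)%:E)%E).
    apply/funext => n /=.
    by rewrite -(L2norm_sqr (L2B fL (gL n))).
  exact: fine_cvg.
have e20 : 0 < e ^+ 2 by rewrite exprn_gt0.
move: cvg0 => /cvgr0_norm_lt/(_ _ e20)[N _ NP].
exists N.+1; split => //; first exact: gL.
have := NP N.+1 (leqnSn N); rewrite ger0_norm ?sqr_ge0// => /ltW.
by rewrite ler_pXn2r// nnegrE ?(ltW e0)// L2norm_ge0.
Unshelve. all: by end_near. Qed.

Lemma continuous_maxr (f g : R -> R) : continuous f -> continuous g ->
  continuous (fun x => Num.max (f x) (g x)).
Proof. by move=> cf cg x; exact: (@continuous_max R R f g x (cf x) (cg x)). Qed.

Lemma continuous_minr (f g : R -> R) : continuous f -> continuous g ->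
  continuous (fun x => Num.min (f x) (g x)).
Proof. by move=> cf cg x; exact: (@continuous_min R R f g x (cf x) (cg x)). Qed.

Lemma ler_dist_clamp (M g h : R) : `|g| <= M ->
  `|g - Num.max (- M) (Num.min M h)| <= `|g - h|.
Proof.
rewrite ler_norml => /andP[G1 G2].
have n1 := ler_norm (g - h).
have n2 : h - g <= `|g - h| by rewrite distrC ler_norm.
rewrite ler_norml; apply/andP.
by case: (leP M h) => ?; [case: (leP (- M) M) => ?|case: (leP (- M) h) => ?]; split; lra.
Qed.

(** Continuous functions are dense in L1 of a bounded interval. Clamping to [[- M, M]] brings no
    loss, as it is a contraction that fixes [G], and it provides the common bound through which L1
    closeness will give L2 closeness. *)
Lemma L1_clamped_approximation (G : R -> R) (b M e : R) : 0 < b -> 0 < e ->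
  measurable_fun setT G -> (forall x, `|G x| <= M) ->
  exists h : R -> R, [/\ continuous h, forall x, `|h x| <= M &
    (\int[mu]_(x in `[0%R, b]) `|G x - h x|%:E < e%:E)%E].
Proof.
move=> b0 e0 mG GM.
have M0 : 0 <= M := le_trans (normr_ge0 _) (GM 0).
have mb : (mu `[0%R, b]%classic < +oo)%E.
  by rewrite lebesgue_measure_itv/= lte_fin b0 -EFinB ltry.
have iG : mu.-integrable `[0%R, b]%classic (EFin \o G).
  apply: measurable_bounded_integrable => //; first exact: measurable_funTS.
  by exists M; split; rewrite ?num_real// => y My x _ /=; rewrite (le_trans (GM x))// ltW.
have [h_ [ch ih]] := approximation_continuous_integrable (measurable_itv _) mb iG.
have eE : (0 < e%:E :> \bar R)%E by rewrite lte_fin.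
move=> hcvg.
have [n nP] : exists n, (\int[mu]_(x in `[0%R, b]) `|(G x - h_ n x)%:E| < e%:E)%E.
  have fin n : (\int[mu]_(x in `[0%R, b]) `|(G x - h_ n x)%:E|)%E \is a fin_num.
    apply: integrable_fin_num => //; apply: integrable_abse.
    by have /= := integrableB _ iG (ih n); apply.
  move: hcvg => /fine_cvg/cvgr0_norm_lt/(_ _ e0)[N _ NP].
  exists N; have := NP N (leqnn N) => /= H.
  by rewrite -(fineK (fin N)) lte_fin (le_lt_trans _ H)// ler_norm.
have clamp_cont : continuous (fun x => Num.max (- M) (Num.min M (h_ n x))).
  apply: continuous_maxr; first exact: cst_continuous.
  by apply: continuous_minr; [exact: cst_continuous|exact: ch].
exists (fun x => Num.max (- M) (Num.min M (h_ n x))); split.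
- exact: clamp_cont.
- by move=> x; rewrite ler_norml le_max lexx/= ge_max ge_min lexx andbT; lra.
- apply: le_lt_trans nP; apply: ge0_le_integral => //=.
  + apply/measurable_EFinP; apply: measurableT_comp => //; apply: measurable_funB.
      exact: measurable_funTS.
    apply: measurable_funTS; apply: continuous_measurable_fun => x.
    exact: clamp_cont.
  + apply/measurable_EFinP; apply: measurableT_comp => //; apply: measurable_funB.
      exact: measurable_funTS.
    by apply: measurable_funTS; apply: continuous_measurable_fun.
  + by move=> x _; rewrite lee_fin; exact: ler_dist_clamp.
Qed.

End density.

Section gaussian_density_odd.
Context {R : realType}.
Notation mu := (@lebesgue_measure R).

Lemma odd_integral_sqr (u : R -> R) : measurable_fun setT u ->
  (fun x => u (- x)) = (fun x => - u x) %[ae mu] ->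
  (\int[mu]_x (u x ^+ 2)%:E = 2%:E * \int[mu]_(x in `[0%R, +oo[) (u x ^+ 2)%:E)%E.
Proof.
move=> mu_ ou; have mu2 : measurable_fun setT (fun x => (u x ^+ 2)%:E).
  by apply/measurable_EFinP; exact: measurable_funX.
have mN := measurable_comp_opp mu_.
have mu2N : measurable_fun setT (fun x : R => (u (- x) ^+ 2)%:E).
  apply/measurable_EFinP; exact: measurable_funX.
rewrite integral_half// [X in (_ + X)%E](_ : _ =
  \int[mu]_(x in `[0%R, +oo[) (u x ^+ 2)%:E)%E; last first.
  apply: ae_eq_integral => //; try exact: measurable_funTS.
  by apply: ae_impl ou => x /= /(_ I) -> _; rewrite sqrrN.
by rewrite mule_natl mule2n.
Qed.

(** Passage from L1 to L2: one factor of [u ^+ 2] is bounded by a constant, contained in [K], and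
    the other is compared with [w]. The 2 in [2 * K] counts the two half-lines. *)
Lemma odd_L2norm_le (u w : R -> R) (b K e : R) : L2 u -> measurable_fun setT w ->
  (fun x => u (- x)) = (fun x => - u x) %[ae mu] ->
  0 < K -> 0 < e ->
  (forall x, 0 <= x <= b -> u x ^+ 2 <= K * `|w x|) -> (forall x, b < x -> u x = 0) ->
  (\int[mu]_(x in `[0%R, b]) `|w x|%:E < (e ^+ 2 / (2 * K))%:E)%E ->
  L2norm u <= e.
Proof.
move=> uL mw ou K0 e0 uw u0 we; apply: L2norm_le => //; first exact: ltW.
rewrite odd_integral_sqr//; last exact: L2_measurable.
have : (\int[mu]_(x in `[0%R, +oo[) (u x ^+ 2)%:E <=
        \int[mu]_(x in `[0%R, b]) (K%:E * `|w x|%:E))%E.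
  rewrite integral_mkcond [leRHS]integral_mkcond; apply: ge0_le_integral => //.
  - by move=> x _; rewrite patchE; case: ifP => // _; rewrite lee_fin sqr_ge0.
  - apply/measurable_restrict => //; apply: measurable_funTS.
    by apply/measurable_EFinP/measurable_funX; exact: L2_measurable.
  - apply/measurable_restrict => //; apply: measurable_funTS.
    by apply: measurable_funeM; apply/measurable_EFinP; exact: measurableT_comp.
  - move=> x _; rewrite !patchE.
    have [|] := boolP (x \in `[0%R, b]%classic).
      rewrite inE/= => xb; rewrite ifT; last first.
        by rewrite inE/= in_itv/= andbT; move: xb; rewrite in_itv/= => /andP[].
      by rewrite -EFinM lee_fin; apply: uw; move: xb; rewrite in_itv.
    rewrite notin_setE/= in_itv/= => xb; case: ifP => //.
    rewrite inE/= in_itv/= andbT => x0; rewrite u0 ?expr0n//.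
    by rewrite ltNge; apply/negP => xb'; apply: xb; rewrite x0.
rewrite ge0_integralZl//=; last 2 first.
- by apply: measurable_funTS; apply/measurable_EFinP; exact: measurableT_comp.
- by rewrite lee_fin ltW.
move=> /le_trans H; rewrite (@le_trans _ _ (2%:E * (K%:E * (e ^+ 2 / (2 * K))%:E)))%E//.
  rewrite lee_pmul2l//; apply: H; rewrite lee_pmul2l ?lte_fin//; exact: ltW.
by rewrite -!EFinM lee_fin le_eqVlt; apply/orP; left; apply/eqP; field; rewrite gt_eqF.
Qed.

(** Three errors of [e / 3]: truncation ([f] to [g]), continuous approximation of the quotient ([g]
    to [r]), and polynomial approximation ([r] to [t]). Oddness is carried by the factor [W], so
    only the values of the quotient on the half-line have to be approximated. *)
Lemma poly_gaussian_density (p0 e : R) (f : R -> R) : 0 < p0 -> 0 < e ->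
  Htilde0 f -> exists q : {poly R},
  let g := fun x : R => x * expR (- (p0 * x ^+ 2)) * q.[expR (- (x ^+ 2))] in
  L2 g /\ L2norm (f \- g) <= e.
Proof.
move=> p00 e0 [fL fodd].
have e30 : 0 < e / 3 by rewrite divr_gt0.
have [N /= [N0 gL fg]] := L2_truncation fL e30.
set g := (fun x => if _ then f x else 0) in gL fg.
have mg := L2_measurable gL.
have N0R : 0 < N%:R :> R by rewrite ltr0n.
pose W x : R := x * expR (- (p0 * x ^+ 2)).
have cW : continuous W.
  by move=> x; apply: cvgM; [exact: cvg_id|exact: continuous_gauss].
have mW : measurable_fun setT W by exact: continuous_measurable_fun.
(* The quotient of [g] by [W]. Its bound [M] takes both truncation conditions, one against [x^-1]
   and the other against the growing exponential. At 0 the quotient is 0, consistently with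
   [g 0 = 0]. *)
pose G x := g x * (x^-1 * expR (p0 * x ^+ 2)).
pose M : R := N%:R * expR (p0 * N%:R ^+ 2).
have M0 : 0 < M by rewrite mulr_gt0 ?expR_gt0.
have GW x : g x = W x * G x.
  have [->|x0] := eqVneq x 0.
    rewrite /W mul0r mul0r /g normr0 mulr0 normr_le0.
    by case: eqP => //= ->; case: ifP.
  rewrite /W /G expRN; field.
  by rewrite x0 gt_eqF ?expR_gt0.
have GM x : `|G x| <= M.
  rewrite /G /g; case: ifPn => [/andP[fx xN]|_]; last first.
    by rewrite mul0r normr0 ltW.
  rewrite !normrM (ger0_norm (expR_ge0 _)) normfV mulrA ler_pM//.
  - have [->|x0] := eqVneq x 0; first by rewrite normr0 invr0 mulr0.
    by rewrite ler_pdivrMr// normr_gt0.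
  - rewrite ler_expR ler_pM2l// -(real_normK (num_real x)).
    by rewrite ler_pXn2r// ?nnegrE.
have mG : measurable_fun setT G.
  apply: measurable_funM => //; apply: measurable_funM; last first.
    apply: measurableT_comp => //; apply: measurable_funM => //.
  exact: measurable_invr.
pose b : R := N%:R + 1.
have b0 : 0 < b by rewrite addr_gt0.
pose K := b ^+ 2 * (2 * M).
have K0 : 0 < K := mulr_gt0 (exprn_gt0 2 b0) (mulr_gt0 (ltr0Sn R 1) M0).
pose eta := (e / 3) ^+ 2 / (2 * K).
have eta0 : 0 < eta := divr_gt0 (exprn_gt0 2 e30) (mulr_gt0 (ltr0Sn R 1) K0).
have [h1 [ch1 h1M Gh1]] := L1_clamped_approximation b0 eta0 mG GM.
(* Continuous cutoff, 1 up to [N%:R] and 0 from [b] on. As [G] vanishes beyond [N%:R], multiplying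
   [h1] by it does not increase the distance to [G]. *)
pose chi x : R := Num.max 0 (Num.min 1 (b - x)).
have cchi : continuous chi.
  apply: continuous_maxr; first exact: cst_continuous.
  apply: continuous_minr; first exact: cst_continuous.
  by move=> x; apply: cvgB; [exact: cvg_cst|].
have chi01 x : 0 <= chi x <= 1.
  rewrite /chi le_max lexx/= ge_max ge_min lexx; lra.
have chi_out x : b <= x -> chi x = 0.
  by move=> bx; apply/max_idPl; rewrite ge_min; apply/orP; right; lra.
have chi_in x : x <= N%:R -> chi x = 1.
  move=> xN; rewrite /chi (min_idPl _) ?(max_idPr _)//.
  by rewrite /b; lra.
pose h2 x := h1 x * chi x.
have ch2 : continuous h2 by move=> x; apply: cvgM; [exact: ch1|exact: cchi].
have Gx x : N%:R < x -> G x = 0.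
  move=> Nx; rewrite /G /g; case: ifPn; rewrite ?mul0r// => /andP[_].
  by rewrite leNgt (lt_le_trans Nx)// ler_norm.
have Gchi x : G x = G x * chi x.
  by have [/chi_in ->|/Gx ->] := leP x N%:R; rewrite ?mulr1 ?mul0r.
have Gh2 x : `|G x - h2 x| <= `|G x - h1 x|.
  have/andP[? ?] := chi01 x.
  by rewrite {1}Gchi -mulrBl normrM (ger0_norm (x := chi x))// ler_piMr.
have Gh22 x : `|G x - h2 x| <= 2 * M.
  apply: (le_trans (Gh2 x)); rewrite (le_trans (ler_normB _ _))// mulrDl mul1r.
  by rewrite lerD.
(* Evaluating [h2] at [|x|] makes [r] odd and turns its second factor into a function of [x ^+ 2],
   hence of [expR (- x ^+ 2)]. *)
pose r x := W x * h2 `|x|.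
have mr : measurable_fun setT r.
  apply: measurable_funM => //; apply: measurableT_comp => //.
  exact: continuous_measurable_fun.
have h2M x : `|h2 x| <= M.
  have/andP[? ?] := chi01 x.
  by rewrite normrM (ger0_norm (x := chi x))// (le_trans _ (h1M x))// ler_piMr.
have Wx x : `|W x| <= (1 + x ^+ 2) ^+ 1 * expR (- (p0 * x ^+ 2)).
  rewrite normrM (ger0_norm (expR_ge0 _)) ler_wpM2r ?expR_ge0// expr1.
  rewrite -(real_normK (num_real x)); have := sqr_ge0 (`|x| - 1); nra.
have [Kq Kq0 KqP] := @L2_gauss_dominated R 1 p0 p00.
have rL : L2 r.
  have [] := KqP M r mr => // x.
  by rewrite normrM mulrC ler_pM.
have gr : L2norm (g \- r) <= e / 3.
  apply: (@odd_L2norm_le _ (fun x => G x - h1 x) b K (e / 3)) => //.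
  - exact: L2B.
  - apply: measurable_funB => //; exact: continuous_measurable_fun.
  - apply: ae_impl fodd => x fx _.
    rewrite /= /g /r /W sqrrN normrN fx// normrN.
    by case: ifP => _; ring.
  - move=> x /andP[x0 xb] /=.
    rewrite GW /r ger0_norm// -mulrBr exprMn.
    rewrite -(real_normK (num_real (W x))) -(real_normK (num_real (G x - h2 x))).
    rewrite /K -mulrA ler_pM ?sqr_ge0//.
      rewrite ler_pXn2r// ?nnegrE ?(ltW b0)// normrM (ger0_norm x0).
      rewrite (ger0_norm (expR_ge0 _)) (le_trans _ xb)// ler_piMr//.
      by rewrite -[leRHS]expR0 ler_expR oppr_le0 mulr_ge0 ?(ltW p00)// sqr_ge0.
    by rewrite expr2 ler_pM.
  - move=> x bx /=; rewrite GW Gx ?mulr0 ?sub0r; last first.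
      by rewrite (lt_trans _ bx)// ltrDl.
    have x0 : 0 <= x by rewrite ltW// (lt_trans b0).
    by rewrite /r /h2 ger0_norm// chi_out ?mulr0 ?oppr0// ltW.
pose c : R := expR (- b ^+ 2).
have c0 : 0 < c by rewrite expR_gt0.
(* [F] is [h2] in the variable [z = expR (- x^2)]; cutting [z] off at [c] is
   harmless because [h2] vanishes beyond [b], and makes [F] continuous at [0]. *)
pose F z := h2 (Num.sqrt (- ln (Num.max z c))).
have cF : continuous F.
  move=> z.
  have cmax : continuous (fun z : R => Num.max z c).
    by apply: continuous_maxr; [move=> ?; exact: cvg_id|exact: cst_continuous].
  have cln : {for z, continuous (fun z => ln (Num.max z c))}.
    apply: (@continuous_comp R R R (fun z => Num.max z c) (@ln R) z); first exact: cmax.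
    by apply: continuous_ln; rewrite lt_max c0 orbT.
  apply: (@continuous_comp R R R (fun z => Num.sqrt (- ln (Num.max z c))) h2 z); last exact: ch2.
  apply: (@continuous_comp R R R (fun z => - ln (Num.max z c)) (@Num.sqrt R) z); last exact: sqrt_continuous.
  exact: cvgN.
have Fz x : F (expR (- (x ^+ 2))) = h2 `|x|.
  rewrite /F; have [xb|bx] := leP `|x| b.
    rewrite (max_idPl _) ?expRK ?opprK ?sqrtr_sqr//.
    rewrite ler_expR lerN2 -(real_normK (num_real x)).
    by rewrite ler_pXn2r// nnegrE// ltW.
  rewrite (max_idPr _); last first.
    rewrite ler_expR lerN2 -(real_normK (num_real x)).
    by rewrite ler_pXn2r// ?nnegrE// ltW.
  rewrite expRK opprK sqrtr_sqr (ger0_norm (ltW b0)) /h2 !chi_out ?mulr0//.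
  exact: ltW.
pose eta' := e / 3 / (Kq + 1).
have eta'0 : 0 < eta' by rewrite divr_gt0// ltr_wpDl.
have [q qF] := weierstrass cF eta'0.
exists q; set t := (fun x : R => W x * q.[expR (- x ^+ 2)]).
rewrite -[X in L2 X]/t -[X in f \- X]/t.
have mt : measurable_fun setT t.
  apply: measurable_funM => //; apply: continuous_measurable_fun => x.
  apply: (@continuous_comp R R R (fun x => expR (- x ^+ 2)) (horner q) x).
    have -> : (fun x : R => expR (- x ^+ 2)) = (fun x => expR (- (1 * x ^+ 2))).
      by apply/funext => y; rewrite mul1r.
    exact: continuous_gauss.
  exact: continuous_horner.
have [rtL rtN] : L2 (r \- t) /\ L2norm (r \- t) <= eta' * Kq.
  apply: KqP; first by apply: measurable_funB.
  move=> x /=; rewrite /r /t -mulrBr normrM mulrC ler_pM//.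
  rewrite -Fz qF// expR_ge0/= -[leRHS]expR0 ler_expR oppr_le0.
  by rewrite sqr_ge0.
have tL : L2 t.
  have -> : t = r \- (r \- t) by apply/funext => x /=; ring.
  exact: L2B.
split => //.
have -> : f \- t = (f \- g) \+ ((g \- r) \+ (r \- t)).
  by apply/funext => x /=; ring.
rewrite (le_trans (L2normD (L2B fL gL) (L2D (L2B gL rL) rtL)))//.
have h := L2normD (L2B gL rL) rtL.
have : eta' * Kq <= e / 3.
  rewrite /eta' mulrAC ler_pdivrMr ?ltr_wpDl// ler_wpM2l ?(ltW e30)//.
  by rewrite lerDl.
move: rtN fg gr h; lra.
Qed.

End gaussian_density_odd.

(** * Heat profiles *)

Section gauss_tail.
Context {R : realType}.
Notation mu := (@lebesgue_measure R).

(** The complementary error function without its normalization: [sqrt pi / 2] times erfc. *)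
Definition gauss_tail (r : R) : R := \int[mu]_(y in `[r, +oo[) gauss_fun y.

Lemma gauss_tail_ge0 r : 0 <= gauss_tail r.
Proof. by apply: Rintegral_ge0 => y _; exact: gauss_fun_ge0. Qed.

(** Since the Gaussian is even, the tail is an integral over []-oo, - r]], with a variable upper end
    as in the fundamental theorem of calculus. *)
Lemma is_derive_gauss_tail (r : R) : is_derive r 1 gauss_tail (- gauss_fun r).
Proof.
pose J (x : R) := \int[mu]_(y in `]-oo, x]) gauss_fun y.
have JP (x : R) : is_derive x 1 J (gauss_fun x).
  have fi : mu.-integrable `]-oo, (x + 1)%R] (EFin \o @gauss_fun R).
    exact: integrableS (@integrableT_gauss R).
  have xx : x < x + 1 by rewrite ltrDl.
  have [|dJ JE] := continuous_FTC1 xx fi _ (@continuous_gauss_fun R x); first exact: ltNyr.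
  apply: DeriveDef; [exact: dJ|by rewrite -derive1E; exact: JE].
have -> : gauss_tail = J \o -%R.
  apply/funext => x; rewrite /gauss_tail /J /= /Rintegral; congr fine.
  rewrite ge0_integration_by_substitutionNy; last first.
  - by move=> y _; exact: gauss_fun_ge0.
  - by apply: continuous_subspaceT; exact: continuous_gauss_fun.
  by apply: eq_integral => y _; rewrite /gauss_fun/= sqrrN.
have := is_derive1_comp (JP (- r)) (is_deriveN (is_derive_id r 1)).
by rewrite mulrN1 /gauss_fun sqrrN.
Qed.

Lemma is_derive_gauss_fun (y : R) :
  is_derive y 1 (@gauss_fun R) (- (2 * y) * gauss_fun y).
Proof.
have := is_derive_gauss 1 y; rewrite mulr1 mul1r.
have -> : (fun x : R => expR (- (1 * x ^+ 2))) = gauss_fun => //.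
by apply/funext => x; rewrite mul1r.
Qed.

(** The function [F] is minus the Gaussian divided by [1 + y]. Its derivative is the Gaussian times
    [1 + y ^+ 2 / (1 + y) ^+ 2], hence dominates the Gaussian, so the tail is at most [- F r].
    Unlike a division by [2 * y], the division by [1 + y] keeps the bound valid down to [r = 0]. *)
Lemma gauss_tail_le r : 0 <= r -> gauss_tail r <= gauss_fun r.
Proof.
move=> r0.
pose F (y : R) := - (gauss_fun y * (1 + y)^-1).
pose f (y : R) := gauss_fun y * (2 * y * (1 + y)^-1 + (1 + y)^-1 ^+ 2).
have y1 (y : R) : 0 <= y -> 1 + y != 0.
  by move=> y0; rewrite gt_eqF// ltr_pwDl.
have FP (y : R) : 0 <= y -> is_derive y 1 F (f y).
  move=> /y1 y0; have := is_derive_gauss_fun y => dg.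
  have dV : is_derive y 1 (fun x => (1 + x)^-1) (- (1 + y) ^- 2).
    by apply: is_derive_eq; rewrite /GRing.scale /= add0r mulr1.
  by apply: is_derive_eq; rewrite /GRing.scale /f /= -exprVn; ring.
have cF (y : R) : 0 <= y -> {for y, continuous F}.
  by move=> /FP[dF _]; apply/differentiable_continuous/derivable1_diffP.
have cf (y : R) : 0 <= y -> {for y, continuous f}.
  move=> /y1 y0.
  have cV : {for y, continuous (fun x : R => (1 + x)^-1)}.
    by apply: cvgV => //; apply: cvgD; [exact: cvg_cst|exact: cvg_id].
  apply: cvgM; first exact: continuous_gauss_fun.
  apply: cvgD.
    by apply: cvgM => //; apply: cvgM; [exact: cvg_cst|exact: cvg_id].
  by apply: cvgM.
have fg (y : R) : 0 <= y -> gauss_fun y <= f y.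
  move=> y0; rewrite /f ler_peMr ?gauss_fun_ge0//.
  have -> : 2 * y * (1 + y)^-1 + (1 + y)^-1 ^+ 2 = 1 + y ^+ 2 / (1 + y) ^+ 2.
    by field; exact: y1.
  by rewrite lerDl divr_ge0 ?sqr_ge0.
have F0 : F y @[y --> +oo] --> (0 : R).
  apply/norm_cvg0P; apply: (squeeze_cvgr _ (cvg_cst 0) (@cvg_gauss_fun R)).
  near=> y; have y0 : 0 <= y by near: y; exact: nbhs_pinfty_ge.
  rewrite normr_ge0/= /F normrN normrM (ger0_norm (gauss_fun_ge0 y)).
  rewrite ler_piMr ?gauss_fun_ge0// ger0_norm; last by rewrite invr_ge0 addr_ge0.
  by rewrite invf_le1 ?lerDl// ltr_pwDl.
have cwf : {within `[r, +oo[, continuous f}.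
  apply/continuous_within_itvcyP; split => [y|].
    by rewrite in_itv/= andbT => ry; apply: cf; rewrite (le_trans r0)// ltW.
  by apply: cvg_at_right_filter; exact: cf.
have H : (\int[mu]_(y in `[r, +oo[) (f y)%:E = 0%:E - (F r)%:E)%E.
  apply: ge0_continuous_FTC2y.
  - by move=> y ry; rewrite (le_trans (gauss_fun_ge0 y))// fg// (le_trans r0).
  - exact: cwf.
  - exact: F0.
  - by move=> x rx; have [] := FP x (le_trans r0 (ltW rx)).
  - by apply: cvg_at_right_filter; exact: cF.
  - move=> x; rewrite in_itv/= andbT => rx; rewrite derive1E.
    by have [_] := FP x (le_trans r0 (ltW rx)).
have I : (\int[mu]_(y in `[r, +oo[) (gauss_fun y)%:E <= (- F r)%:E)%E.
  rewrite (_ : (- F r)%:E = 0%:E - (F r)%:E)%E; last by rewrite -EFinB sub0r.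
  rewrite -H; apply: ge0_le_integral => //.
  - by move=> y _; exact: gauss_fun_ge0.
  - by apply: measurable_funTS; apply/measurable_EFinP; exact: measurable_gauss_fun.
  - by apply/measurable_EFinP; apply: subspace_continuous_measurable_fun.
  - by move=> y; rewrite /= in_itv/= andbT => ry; rewrite lee_fin fg// (le_trans r0).
rewrite -lee_fin /gauss_tail /Rintegral fineK; last first.
  by rewrite ge0_fin_numE ?(le_lt_trans I) ?ltry// integral_ge0// => y _; exact: gauss_fun_ge0.
apply: (le_trans I); rewrite lee_fin /F opprK ler_piMr ?gauss_fun_ge0//.
by rewrite invf_le1 ?lerDl// ltr_pwDl.
Unshelve. all: by end_near. Qed.

End gauss_tail.

Section heat_profiles.
Context {R : realType}.
Notation mu := (@lebesgue_measure R).
Implicit Types (w x : R).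

(** Each of these three profiles is minus the [x]-derivative of the preceding one. At
    [w = (2 sqrt s)^-1] the second is [sqrt pi] times the heat kernel and the third is the [k_s] of
    the overview. *)
Definition heat_tail w x := gauss_tail (w * x).
Definition heat_gauss w x := w * gauss_fun (w * x).
Definition heat_dipole w x := 2 * w ^+ 3 * x * gauss_fun (w * x).

Lemma is_derive_heat_tail w x : is_derive x 1 (heat_tail w) (- heat_gauss w x).
Proof.
have H : is_derive x 1 (fun x : R => w * x) w.
  by apply: is_derive_eq; rewrite /GRing.scale /= mulr1.
by have := is_derive1_comp (is_derive_gauss_tail (w * x)) H; rewrite mulNr mulrC.
Qed.

Lemma is_derive_heat_gauss w x : is_derive x 1 (heat_gauss w) (- heat_dipole w x).
Proof.
have H : is_derive x 1 (fun x : R => w * x) w.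
  by apply: is_derive_eq; rewrite /GRing.scale /= mulr1.
have := is_derive1_comp (is_derive_gauss_fun (w * x)) H => dg.
have := is_deriveZ w dg.
rewrite (_ : w *: _ = - heat_dipole w x); last by rewrite /GRing.scale /heat_dipole /=; ring.
by [].
Qed.

Lemma continuous_heat_tail w : continuous (heat_tail w).
Proof. exact: is_derive_continuous (is_derive_heat_tail w). Qed.

Lemma continuous_heat_gauss w : continuous (heat_gauss w).
Proof. exact: is_derive_continuous (is_derive_heat_gauss w). Qed.

Lemma continuous_heat_dipole w : continuous (heat_dipole w).
Proof.
have -> : heat_dipole w = (fun x => (2 * w ^+ 3) * x * expR (- (w ^+ 2 * x ^+ 2))).
  by apply/funext => x; rewrite /heat_dipole /gauss_fun exprMn.
move=> x; apply: cvgM; last exact: continuous_gauss.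
by apply: cvgM; [exact: cvg_cst|exact: cvg_id].
Qed.

Lemma heat_tail_ge0 w x : 0 <= heat_tail w x. Proof. exact: gauss_tail_ge0. Qed.

Lemma heat_gauss_ge0 w x : 0 <= w -> 0 <= heat_gauss w x.
Proof. by move=> w0; rewrite mulr_ge0// gauss_fun_ge0. Qed.

Lemma heat_dipole_ge0 w x : 0 <= w -> 0 <= x -> 0 <= heat_dipole w x.
Proof. by move=> w0 x0; rewrite !mulr_ge0// ?exprn_ge0// gauss_fun_ge0. Qed.

Lemma heat_tail_le w x : 0 <= w -> 0 <= x -> heat_tail w x <= expR (- (w ^+ 2 * x ^+ 2)).
Proof.
by move=> w0 x0; rewrite (le_trans (gauss_tail_le _)) ?mulr_ge0// /gauss_fun exprMn.
Qed.

Lemma cvg_gauss_scale w : 0 < w -> gauss_fun (w * x) @[x --> +oo] --> (0 : R).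
Proof.
move=> w0; apply: (cvg_comp (fun x : R => w * x) (@gauss_fun R)); last exact: cvg_gauss_fun.
apply/cvgryPge => A; by near=> x; rewrite -ler_pdivrMl.
Unshelve. all: by end_near. Qed.

Lemma integral_heat_gauss w x : 0 < w -> 0 <= x ->
  (\int[mu]_(y in `[x, +oo[) (heat_gauss w y)%:E = (heat_tail w x)%:E)%E.
Proof.
move=> w0 x0.
have dF (y : R) : is_derive y 1 (\- heat_tail w) (heat_gauss w y).
  by have := is_deriveN (is_derive_heat_tail w y); rewrite opprK.
have cF := is_derive_continuous dF.
rewrite (@ge0_continuous_FTC2y _ (heat_gauss w) (\- heat_tail w) x 0).
- by rewrite sub0e EFinN oppeK.
- by move=> y _; apply: heat_gauss_ge0; exact: ltW.
- by apply: continuous_subspaceT; exact: continuous_heat_gauss.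
- rewrite -oppr0; apply: cvgN; apply: (squeeze_cvgr _ (cvg_cst 0) (cvg_gauss_scale w0)).
  by near=> y; rewrite heat_tail_ge0/= gauss_tail_le// mulr_ge0 ?(ltW w0).
- by move=> y _; have [] := dF y.
- by apply: cvg_at_right_filter; exact: cF.
- by move=> y _; rewrite derive1E; have [_] := dF y.
Unshelve. all: by end_near. Qed.

Lemma integral_heat_dipole w x : 0 < w -> 0 <= x ->
  (\int[mu]_(y in `[x, +oo[) (heat_dipole w y)%:E = (heat_gauss w x)%:E)%E.
Proof.
move=> w0 x0.
have dF (y : R) : is_derive y 1 (\- heat_gauss w) (heat_dipole w y).
  by have := is_deriveN (is_derive_heat_gauss w y); rewrite opprK.
have cF := is_derive_continuous dF.
rewrite (@ge0_continuous_FTC2y _ (heat_dipole w) (\- heat_gauss w) x 0).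
- by rewrite sub0e EFinN oppeK.
- by move=> y xy; apply: heat_dipole_ge0; [exact: ltW|exact: le_trans xy].
- by apply: continuous_subspaceT; exact: continuous_heat_dipole.
- rewrite -oppr0; apply: cvgN; rewrite -(mulr0 w).
  by apply: cvgM; [exact: cvg_cst|exact: cvg_gauss_scale].
- by move=> y _; have [] := dF y.
- by apply: cvg_at_right_filter; exact: cF.
- by move=> y _; rewrite derive1E; have [_] := dF y.
Qed.

End heat_profiles.

Section half_line_parts.
Context {R : realType}.
Notation mu := (@lebesgue_measure R).

(* Fubini on [0 < x <= y] replaces integration by parts: no boundary term at
   infinity has to be controlled. *)
Lemma parts_half_line (p q f f' : R -> R) :
  measurable_fun setT q -> measurable_fun setT f' ->
  (forall x, 0 < x -> 0 <= q x) ->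
  (forall x, 0 < x -> (\int[mu]_(y in `[x, +oo[) (q y)%:E = (p x)%:E)%E) ->
  mu.-integrable `]0%R, +oo[ (EFin \o (fun x => p x * f' x)) ->
  (forall y, 0 < y -> mu.-integrable `[0%R, y] (EFin \o f') /\
     f y = f 0 + \int[mu]_(x in `[0%R, y]) f' x) ->
  \int[mu]_(x in `]0%R, +oo[) (p x * f' x) =
  \int[mu]_(y in `]0%R, +oo[) (q y * (f y - f 0)).
Proof.
move=> mq mf' q0 pq ipf fac.
pose h (z : R * R) := (if (0 < z.1) && (z.1 <= z.2) then f' z.1 * q z.2 else 0)%R.
have mh : measurable_fun setT (EFin \o h).
  apply/measurable_EFinP; apply: measurable_fun_ifT => //.
    apply: measurable_and.
      by apply: measurable_fun_ltr => //; exact: measurable_fst.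
    by apply: measurable_fun_ler; [exact: measurable_fst|exact: measurable_snd].
  apply: measurable_funM.
    by apply: measurableT_comp => //; exact: measurable_fst.
  by apply: measurableT_comp => //; exact: measurable_snd.
have p0 x : 0 < x -> 0 <= p x.
  move=> x0; rewrite -lee_fin -pq// integral_ge0// => y /=.
  by rewrite in_itv/= andbT => xy; rewrite lee_fin q0// (lt_le_trans x0).
have iq x : 0 < x -> mu.-integrable `[x, +oo[ (EFin \o q).
  move=> x0; apply/integrableP; split.
    by apply: measurable_funTS; exact/measurable_EFinP.
  rewrite [ltLHS](_ : _ = (p x)%:E) ?ltry// -pq//.
  apply: eq_integral => y; rewrite inE/= in_itv/= andbT => xy.
  by rewrite ger0_norm// q0// (lt_le_trans x0).
have Iy (x c : R) : (\int[mu]_y (if ((0 < x) && (x <= y))%R then c * q y else 0)%:E =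
    (if 0 < x then c * p x else 0)%:E)%E.
  case: ifPn => x0 /=; last by rewrite integral0_eq.
  rewrite EFinM -pq// -integralZl//; last exact: iq.
  rewrite [RHS]integral_mkcond; apply: eq_integral => y _.
  by rewrite patchE mem_setE in_itv/= andbT; case: ifP.
have ih : (mu \x mu)%E.-integrable setT (EFin \o h).
  (* As [q] is nonnegative, integrating the absolute value of [h] in [y] first gives [|p x * f' x|],
     which is integrable by hypothesis. *)
  apply/integrable12ltyP; first exact: mh.
  have /integrableP[_] := ipf; apply: le_lt_trans.
  rewrite [leRHS]integral_mkcond le_eqVlt; apply/orP; left; apply/eqP.
  apply: eq_integral => x _.
  rewrite patchE mem_setE in_itv/= andbT.
  transitivity (\int[mu]_y (if ((0 < x) && (x <= y))%R then `|f' x| * q y else 0)%:E)%E.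
    apply: eq_integral => y _; rewrite /h /=; case: ifP => [/andP[x0 xy]|_].
      by rewrite normrM (ger0_norm (q0 _ (lt_le_trans x0 xy))).
    by rewrite normr0.
  rewrite Iy; case: ifPn => // x0 /=.
  by rewrite normrM (ger0_norm (p0 _ x0)) mulrC.
have := Fubini ih => /= FE; rewrite /Rintegral; congr fine.
transitivity (\int[mu]_x \int[mu]_y (h (x, y))%:E)%E.
  rewrite integral_mkcond; apply: eq_integral => x _.
  rewrite patchE mem_setE in_itv/= andbT; rewrite /h /=.
  by rewrite Iy; case: ifP => // _; rewrite mulrC.
rewrite FE [RHS]integral_mkcond; apply: eq_integral => y _.
rewrite patchE mem_setE in_itv/= andbT; case: ifPn => y0; last first.
  apply: integral0_eq => x _; rewrite /h/=; case: ifP => // /andP[x0 xy].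
  by rewrite (lt_le_trans x0 xy) in y0.
have [if' ->] := fac _ y0.
rewrite [in RHS]addrAC subrr add0r /Rintegral mulrC EFinM fineK; last exact: integrable_fin_num.
rewrite -integral_itv_obnd_cbnd; last first.
  by apply: measurable_funTS; exact/measurable_EFinP.
rewrite muleC -integralZl//; last by apply: integrableS if' => //; exact: subset_itv_oc_cc.
rewrite [RHS]integral_mkcond; apply: eq_integral => x _.
rewrite patchE mem_setE in_itv/= /h/=; case: ifP => // _.
by rewrite -EFinM mulrC.
Qed.

End half_line_parts.

(** * Dependence of the profiles on time *)

Section heat_time.
Context {R : realType}.
Notation mu := (@lebesgue_measure R).
Implicit Types (a s t x : R).

(* [heat_rate 0 = 0], as the inverse of 0 is 0, so that [heat_dipole (heat_rate 0)]
   is the null function. *)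
Definition heat_rate s : R := (2 * Num.sqrt s)^-1.

Lemma heat_rate_gt0 s : 0 < s -> 0 < heat_rate s.
Proof. by move=> s0; rewrite invr_gt0 mulr_gt0// sqrtr_gt0. Qed.

Lemma heat_rate_sqr s : 0 < s -> heat_rate s ^+ 2 = (4 * s)^-1.
Proof.
move=> s0; rewrite exprVn exprMn sqr_sqrtr ?(ltW s0)//.
by congr (_^-1); ring.
Qed.

Lemma is_derive_heat_rate s : 0 < s ->
  is_derive s 1 heat_rate (- (2 * heat_rate s ^+ 3)).
Proof.
move=> s0; have q0 : 0 < Num.sqrt s by rewrite sqrtr_gt0.
have ds := is_derive1_sqrt s0.
have d2 : is_derive s 1 (fun s => 2 * Num.sqrt s) (Num.sqrt s)^-1.
  apply: is_derive_eq; rewrite /GRing.scale/=.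
  by field; rewrite gt_eqF.
have n0 : 2 * Num.sqrt s != 0 by rewrite mulf_neq0// gt_eqF.
have := @is_deriveV _ (fun s => 2 * Num.sqrt s) s _ 1 n0 d2.
rewrite (_ : _ *: _ = - (2 * heat_rate s ^+ 3))//.
by rewrite /heat_rate /GRing.scale/=; field; rewrite gt_eqF.
Qed.

(** The heat equation for [heat_tail], whose second [x]-derivative is also [heat_dipole]. The factor
    [2 w^3] comes from the derivative [- 2 w^3] of [heat_rate]. *)
Lemma is_derive_time_heat_tail s x : 0 < s ->
  is_derive s 1 (fun s => heat_tail (heat_rate s) x) (heat_dipole (heat_rate s) x).
Proof.
move=> s0; have dr := is_derive_heat_rate s0.
have dx : is_derive s 1 (fun s => heat_rate s * x) (- (2 * heat_rate s ^+ 3) * x).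
  by apply: is_derive_eq; rewrite /GRing.scale/=; ring.
have -> : heat_dipole (heat_rate s) x =
    - gauss_fun (heat_rate s * x) * (- (2 * heat_rate s ^+ 3) * x).
  by rewrite /heat_dipole; ring.
exact: (@is_derive1_comp R (@gauss_tail R) (fun s => heat_rate s * x)
  s _ _ (is_derive_gauss_tail _) dx).
Qed.

Lemma gauss_fun_le_inv (y : R) : 0 < y -> gauss_fun y <= (y ^+ 2)^-1.
Proof.
move=> y0; rewrite /gauss_fun expRN lef_pV2 ?posrE ?expR_gt0 ?exprn_gt0//.
by rewrite (le_trans _ (expR_ge1Dx _))// lerDr.
Qed.

(** From [y ^+ 4 / 2 <= expR (y ^+ 2)]. The fourth power beats the [w ^+ 3] in [heat_dipole] and
    leaves [w^-1], that is, a factor [sqrt s] that vanishes at [s = 0]. *)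
Lemma gauss_fun_le_inv4 (y : R) : 0 < y -> gauss_fun y <= 2 * (y ^+ 4)^-1.
Proof.
move=> y0; have y2 : 0 <= y ^+ 2 by rewrite sqr_ge0.
rewrite /gauss_fun expRN -[leRHS]invrK invrM ?unitfE ?gt_eqF ?invr_gt0 ?exprn_gt0// invrK.
rewrite lef_pV2 ?posrE ?expR_gt0 ?divr_gt0 ?exprn_gt0//.
by rewrite (le_trans _ (expR_ge1Dxn 1 y2))//= -exprM lerDr.
Qed.

Lemma heat_tail_time_le s x : 0 < s -> 0 < x ->
  heat_tail (heat_rate s) x <= 4 * s / x ^+ 2.
Proof.
move=> s0 x0; have r0 := heat_rate_gt0 s0.
have rx : 0 < heat_rate s * x by rewrite mulr_gt0.
apply: (le_trans (gauss_tail_le (ltW rx))).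
apply: (le_trans (gauss_fun_le_inv rx)).
rewrite exprMn heat_rate_sqr//.
by rewrite le_eqVlt; apply/orP; left; apply/eqP; field; rewrite !gt_eqF.
Qed.

Lemma heat_dipole_time_le s x : 0 < s -> 0 < x ->
  heat_dipole (heat_rate s) x <= 8 / x ^+ 3 * Num.sqrt s.
Proof.
move=> s0 x0; have r0 := heat_rate_gt0 s0; have q0 : 0 < Num.sqrt s by rewrite sqrtr_gt0.
rewrite /heat_dipole (le_trans (ler_wpM2l _ (gauss_fun_le_inv4 _))) ?mulr_gt0//.
  by rewrite !mulr_ge0// ?exprn_ge0// ltW.
rewrite le_eqVlt /heat_rate; apply/orP; left; apply/eqP.
by field; rewrite !gt_eqF.
Qed.

Lemma integral_time_heat_dipole a t x : a < t -> 0 < x ->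
  (\int[mu]_(s in `[a, t]) (heat_dipole (heat_rate (s - a)) x)%:E =
   (heat_tail (heat_rate (t - a)) x)%:E)%E.
Proof.
move=> at_ x0.
(* With [heat_rate 0 = 0], [heat_tail] at [s = a] would be [gauss_tail 0], whereas its limit from
   the right is 0; hence the separate case. For [heat_dipole] the same convention gives the correct
   limit 0. *)
pose F s := if s <= a then 0 else heat_tail (heat_rate (s - a)) x.
have k0 : heat_dipole (heat_rate (a - a)) x = 0.
  by rewrite subrr /heat_rate sqrtr0 mulr0 invr0 /heat_dipole expr0n/= mulr0 !mul0r.
have dF s : a < s -> is_derive s 1 F (heat_dipole (heat_rate (s - a)) x).
  move=> as_.
  have ds : is_derive s 1 (fun s => s - a) 1 by apply: is_derive_eq; rewrite subr0.
  have sa : 0 < s - a by rewrite subr_gt0.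
  have := @is_derive1_comp R (fun s => heat_tail (heat_rate s) x) (fun s => s - a)
    s _ _ (is_derive_time_heat_tail x sa) ds; rewrite mulr1.
  apply: near_eq_is_derive; near=> z; rewrite /F /=.
  suff az : a < z by rewrite leNgt az.
  by near: z; exact: lt_nbhsr.
have cF s : a < s -> {for s, continuous F}.
  by move=> /dF[dFs _]; apply/differentiable_continuous/derivable1_diffP.
have ck s : a < s -> {for s, continuous (fun s => heat_dipole (heat_rate (s - a)) x)}.
  move=> as_; have sa : 0 < s - a by rewrite subr_gt0.
  have cr : {for s, continuous (fun s => heat_rate (s - a))}.
    apply: (@continuous_comp R R R (fun s => s - a) heat_rate s).
      by apply: cvgB; [exact: cvg_id|exact: cvg_cst].
    have [dr _] := is_derive_heat_rate sa.
    exact/differentiable_continuous/derivable1_diffP.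
  apply: cvgM; first apply: cvgM; last first.
  - apply: (@continuous_comp R R R (fun s => heat_rate (s - a) * x) (@gauss_fun R) s).
      by apply: cvgM; [exact: cr|exact: cvg_cst].
    exact: continuous_gauss_fun.
  - exact: cvg_cst.
  - apply: cvgM; first exact: cvg_cst.
    apply: (@continuous_comp R R R (fun s => heat_rate (s - a)) (fun w => w ^+ 3) s) => //.
    exact: exprn_continuous.
have Fa : F a = 0 by rewrite /F lexx.
have Fa0 : F s @[s --> a^'+] --> F a.
  rewrite Fa.
  have c0 : 4 * (s - a) / x ^+ 2 @[s --> a^'+] --> (0 : R).
    rewrite [X in _ --> X](_ : _ = 4 * (a - a) / x ^+ 2); last by rewrite subrr mulr0 mul0r.
    apply: cvg_at_right_filter; apply: cvgM; last exact: cvg_cst.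
    by apply: cvgM; [exact: cvg_cst|apply: cvgB; [exact: cvg_id|exact: cvg_cst]].
  apply: (squeeze_cvgr _ (cvg_cst 0) c0); near=> s.
  have as_ : a < s by [].
  have sa : (s <= a) = false by rewrite leNgt as_.
  by rewrite /F sa heat_tail_ge0/= heat_tail_time_le// subr_gt0.
have ka0 : heat_dipole (heat_rate (s - a)) x @[s --> a^'+] --> heat_dipole (heat_rate (a - a)) x.
  rewrite k0.
  have c0 : 8 / x ^+ 3 * Num.sqrt (s - a) @[s --> a^'+] --> (0 : R).
    rewrite [X in _ --> X](_ : _ = 8 / x ^+ 3 * Num.sqrt (a - a)); last by rewrite subrr sqrtr0 mulr0.
    apply: cvg_at_right_filter; apply: cvgM; first exact: cvg_cst.
    apply: (@continuous_comp R R R (fun s => s - a) Num.sqrt a); last exact: sqrt_continuous.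
    by apply: cvgB; [exact: cvg_id|exact: cvg_cst].
  apply: (squeeze_cvgr _ (cvg_cst 0) c0); near=> s.
  have as_ : 0 < s - a by rewrite subr_gt0.
  rewrite heat_dipole_ge0 ?(ltW x0) ?heat_dipole_time_le// ltW//.
  exact: heat_rate_gt0.
rewrite (@continuous_FTC2 _ _ F).
- have ta : (t <= a) = false by rewrite leNgt at_.
  by rewrite Fa sube0 /F ta.
- exact: at_.
- apply/continuous_within_itvP => //; split.
  + by move=> s; rewrite in_itv/= => /andP[as_ _]; exact: ck.
  + exact: ka0.
  + by apply: cvg_at_left_filter; exact: ck.
- split.
  + by move=> s; rewrite in_itv/= => /andP[as_ _]; have [] := dF s as_.
  + exact: Fa0.
  + by apply: cvg_at_left_filter; exact: cF.
- by move=> s; rewrite in_itv/= => /andP[as_ _]; rewrite derive1E; have [_] := dF s as_.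
Unshelve. all: by end_near. Qed.

End heat_time.

Section odd_profile.
Context {R : realType}.
Notation mu := (@lebesgue_measure R).
Implicit Types (w x : R).

(** The jump of [2 * gauss_tail 0] across the origin is what produces the [delta'] term of the
    equation. *)
Definition heat_odd w x : R :=
  if 0 < x then heat_tail w x else if x < 0 then - heat_tail w (- x) else 0.

Lemma heat_odd_opp w x : heat_odd w (- x) = - heat_odd w x.
Proof.
rewrite /heat_odd oppr_gt0 oppr_lt0 opprK.
by case: ltgtP => //; rewrite ?opprK ?oppr0.
Qed.

Lemma measurable_heat_odd w : measurable_fun setT (heat_odd w).
Proof.
have mE : measurable_fun setT (heat_tail w).
  by apply: continuous_measurable_fun; exact: continuous_heat_tail.
apply: measurable_fun_ifT => //; first exact: measurable_fun_ltr.
apply: measurable_fun_ifT => //; first exact: measurable_fun_ltr.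
by apply: measurableT_comp => //; exact: measurable_comp_opp.
Qed.

Lemma heat_odd_le w x : 0 <= w -> `|heat_odd w x| <= expR (- (w ^+ 2 * x ^+ 2)).
Proof.
move=> w0; rewrite /heat_odd; case: ltgtP => x0.
- by rewrite ger0_norm ?heat_tail_ge0// heat_tail_le// ltW.
- by rewrite normrN ger0_norm ?heat_tail_ge0// -[x ^+ 2]sqrrN heat_tail_le// oppr_ge0 ltW.
- by rewrite normr0 expR_ge0.
Qed.

(** One bound for all [w >= w0], because the Gaussian majorant decreases in [w]; with
    [w0 = heat_rate T] it covers all durations up to [T]. *)
Lemma L2_heat_odd w0 : 0 < w0 -> exists2 M : R, 0 <= M &
  forall w, w0 <= w -> L2 (heat_odd w) /\ L2norm (heat_odd w) <= M.
Proof.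
move=> w00; have w02 : 0 < w0 ^+ 2 by rewrite exprn_gt0.
have [K K0 KP] := L2_gauss_dominated 0 w02.
exists K => // w ww.
have := KP 1 _ (measurable_heat_odd w); rewrite mul1r; apply => x.
rewrite expr0 !mul1r (le_trans (heat_odd_le _ _))//.
  by rewrite (le_trans (ltW w00)).
by rewrite ler_expR lerN2 ler_wpM2r ?sqr_ge0// ler_pXn2r// nnegrE ltW// (lt_le_trans w00).
Qed.

Lemma L2_heat_gauss w : 0 < w -> L2 (heat_gauss w).
Proof.
move=> w0; have w2 : 0 < w ^+ 2 by rewrite exprn_gt0.
have [K K0 KP] := L2_gauss_dominated 0 w2.
have [] // := KP w (heat_gauss w).
  by apply: continuous_measurable_fun; exact: continuous_heat_gauss.
move=> x; rewrite expr0 mul1r /heat_gauss /gauss_fun exprMn.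
by rewrite ger0_norm// mulr_ge0 ?expR_ge0// ltW.
Qed.

Lemma L2_heat_dipole w : 0 < w -> L2 (heat_dipole w).
Proof.
move=> w0; have w2 : 0 < w ^+ 2 by rewrite exprn_gt0.
have [K K0 KP] := L2_gauss_dominated 1 w2.
have [] // := KP (2 * w ^+ 3) (heat_dipole w).
  by apply: continuous_measurable_fun; exact: continuous_heat_dipole.
move=> x; rewrite expr1 /heat_dipole /gauss_fun exprMn.
have c0 : 0 <= 2 * w ^+ 3 by rewrite mulr_ge0// exprn_ge0// ltW.
rewrite normrM (ger0_norm (expR_ge0 _)) normrM (ger0_norm c0) -mulrA.
rewrite ler_wpM2l// ler_wpM2r ?expR_ge0//.
rewrite -(real_normK (num_real x)); have := sqr_ge0 (`|x| - 1); nra.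
Qed.

Lemma integrable_L2M (D : set R) (f g : R -> R) : measurable D -> L2 f -> L2 g ->
  mu.-integrable D (EFin \o (fun x => f x * g x)).
Proof. by move=> mD fL gL; apply: integrableS (L2_integrableM fL gL). Qed.

Lemma odd_pairing (f g : R -> R) : (forall x, f (- x) = - f x) ->
  L2 f -> L2 g ->
  \int[mu]_x (f x * g x) = \int[mu]_(x in `]0%R, +oo[) (f x * (g x - g (- x))).
Proof.
move=> fo fL gL; have ifg := L2_integrableM fL gL.
have gL' := L2N (L2_comp_opp gL).
have i1 := integrable_L2M (measurable_itv `]0%R, +oo[) fL gL.
have i2 := integrable_L2M (measurable_itv `]0%R, +oo[) fL gL'.
under [RHS]eq_Rintegral do rewrite mulrDr.
rewrite RintegralD// /Rintegral -fineD; try exact: integrable_fin_num.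
rewrite (integral_half_open (measurable_int _ ifg)); congr fine; congr (_ + _)%E.
by apply: eq_integral => x _ /=; rewrite fo mulNr mulrN.
Qed.

End odd_profile.

(** * The equation for the odd profile, tested with [H2] functions *)

Section weak_form.
Context {R : realType}.
Notation mu := (@lebesgue_measure R).

Lemma integrable_patch (D : set R) (f : R -> \bar R) : measurable D ->
  mu.-integrable D f <-> mu.-integrable setT (f \_ D).
Proof.
move=> mD; split => ?; first exact: (integrable_mkcond (mu := mu) f mD).1.
exact: (integrable_mkcond (mu := mu) f mD).2.
Qed.

Lemma ac_derivative_nonneg (f g : R -> R) (y : R) :
  (forall a b, a <= b -> ac_derivative a b f g) -> 0 < y ->
  mu.-integrable `[0, y] (EFin \o g) /\ f y - f 0 = \int[mu]_(x in `[0%R, y]) g x.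
Proof.
move=> /(_ 0 y) fg y0; have [ig fE] := fg (ltW y0); split => //.
rewrite (fE y); last by rewrite in_itv/= lexx ltW.
by ring.
Qed.

Lemma ac_derivative_opp (f g : R -> R) (y : R) : measurable_fun setT g ->
  (forall a b, a <= b -> ac_derivative a b f g) -> 0 < y ->
  mu.-integrable `[0, y] (EFin \o (fun x => g (- x))) /\
  f 0 - f (- y) = \int[mu]_(x in `[0%R, y]) g (- x).
Proof.
move=> mg /(_ (- y) 0) fg y0; have yn : - y <= 0 by rewrite oppr_le0 ltW.
have [ig fE] := fg yn.
have E (x : R) : ((EFin \o g) \_ `[(- y)%R, 0%R]) (- x) =
    ((EFin \o (fun x => g (- x))) \_ `[0%R, y]) x.
  rewrite !patchE !mem_setE !in_itv/= lerN2 oppr_le0 andbC.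
  by case: ifP.
split.
  have : mu.-integrable setT ((EFin \o g) \_ `[(- y)%R, 0%R]).
    exact: (integrable_patch _ (measurable_itv _)).1.
  move=> /integrable_comp_opp; under eq_fun do rewrite E.
  exact: (integrable_patch _ (measurable_itv _)).2.
rewrite (fE 0); last by rewrite in_itv/= lexx oppr_le0 ltW.
rewrite addrAC subrr add0r /Rintegral; congr fine.
rewrite integral_mkcond -integral_opp; last first.
  by apply/measurable_restrict => //; apply: measurable_funTS; exact/measurable_EFinP.
by rewrite [RHS]integral_mkcond; apply: eq_integral => x _; rewrite E.
Qed.

Lemma integral_heat_gauss0 (w : R) : 0 < w ->
  \int[mu]_(x in `]0%R, +oo[) heat_gauss w x = gauss_tail 0.
Proof.
move=> w0; rewrite /Rintegral integral_itv_obnd_cbnd.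
  by rewrite integral_heat_gauss// /heat_tail mulr0.
apply: measurable_funTS; apply/measurable_EFinP.
by apply: continuous_measurable_fun; exact: continuous_heat_gauss.
Qed.

(** Two integrations by parts on the half-line, applied to [psi0], the difference of [phi] and its
    reflection. The step from [psi1] to [psi0] has no boundary term, as [psi0] vanishes at 0; the
    one from [psi2] to [psi1] leaves [psi1 0 = 2 * H2_d1 phi 0] times the integral of [heat_gauss].
    This remainder equals [- 2 * gauss_tail 0 * delta' phi], the contribution of a constant
    control. *)
Lemma heat_dipole_pairing (w : R) (phi : H2) : 0 < w ->
  \int[mu]_(x in `]0%R, +oo[) (heat_dipole w x * (phi x - phi (- x))) =
  dxx (heat_odd w) phi + 2 * H2_d1 phi 0 * gauss_tail 0.
Proof.
move=> w0.
have phiL := H2_val_L2 phi; have phi1L := H2_d1_L2 phi; have phi2L := H2_d2_L2 phi.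
have m1 := L2_measurable phi1L; have m2 := L2_measurable phi2L.
pose psi0 x : R := phi x - phi (- x).
pose psi1 x : R := H2_d1 phi x + H2_d1 phi (- x).
pose psi2 x : R := H2_d2 phi x - H2_d2 phi (- x).
have psi1L : L2 psi1 by apply: L2D => //; exact: L2_comp_opp.
have psi2L : L2 psi2 by apply: L2B => //; exact: L2_comp_opp.
have [_ _ /(_ w (lexx w)) [oL _]] := L2_heat_odd w0.
have gL := L2_heat_gauss w0.
have mI := @measurable_itv R `]0%R, +oo[.
have mhg : measurable_fun setT (heat_gauss w) by exact: L2_measurable.
have heat_tail_odd x : 0 < x -> heat_tail w x = heat_odd w x by move=> x0; rewrite /heat_odd x0.
have S2 : \int[mu]_(x in `]0%R, +oo[) (heat_tail w x * psi2 x) =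
    \int[mu]_(x in `]0%R, +oo[) (heat_gauss w x * (psi1 x - psi1 0)).
  apply: parts_half_line => //.
  - exact: L2_measurable.
  - by move=> x _; apply: heat_gauss_ge0; exact: ltW.
  - by move=> x x0; apply: integral_heat_gauss => //; exact: ltW.
  - apply: eq_integrable (integrable_L2M mI oL psi2L) => // x.
    by rewrite inE/= in_itv/= andbT => x0; rewrite heat_tail_odd.
  - move=> y y0.
    have [i1 e1] := ac_derivative_nonneg (@H2_d1_d2 _ phi) y0.
    have [i2 e2] := ac_derivative_opp m2 (@H2_d1_d2 _ phi) y0.
    split.
      by have /= := integrableB _ i1 i2; apply.
    by rewrite /psi2 RintegralB// -e1 -e2 /psi1 oppr0; ring.
have S1 : \int[mu]_(x in `]0%R, +oo[) (heat_gauss w x * psi1 x) =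
    \int[mu]_(x in `]0%R, +oo[) (heat_dipole w x * (psi0 x - psi0 0)).
  apply: parts_half_line => //.
  - by apply: L2_measurable; exact: L2_heat_dipole.
  - exact: L2_measurable.
  - by move=> x x0; apply: heat_dipole_ge0; exact: ltW.
  - by move=> x x0; apply: integral_heat_dipole => //; exact: ltW.
  - exact: integrable_L2M.
  - move=> y y0.
    have [i1 e1] := ac_derivative_nonneg (@H2_val_d1 _ phi) y0.
    have [i2 e2] := ac_derivative_opp m1 (@H2_val_d1 _ phi) y0.
    split.
      by have /= := integrableD _ i1 i2; apply.
    by rewrite /psi1 RintegralD// -e1 -e2 /psi0 oppr0; ring.
have -> : dxx (heat_odd w) phi = \int[mu]_(x in `]0%R, +oo[) (heat_tail w x * psi2 x).
  rewrite /dxx odd_pairing//; last by move=> x; exact: heat_odd_opp.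
  apply: eq_Rintegral => x; rewrite inE/= in_itv/= andbT => x0.
  by rewrite heat_tail_odd.
have -> : \int[mu]_(x in `]0%R, +oo[) (heat_dipole w x * (phi x - phi (- x))) =
    \int[mu]_(x in `]0%R, +oo[) (heat_gauss w x * psi1 x).
  by rewrite S1; apply: eq_Rintegral => x _; rewrite /psi0 oppr0 subrr subr0.
have ig : mu.-integrable `]0%R, +oo[ (EFin \o heat_gauss w).
  apply/integrableP; split; first by apply: measurable_funTS; exact/measurable_EFinP.
  have := integral_heat_gauss w0 (lexx 0) => Ig.
  rewrite [ltLHS](_ : _ = (heat_tail w 0)%:E) ?ltry// -Ig integral_itv_obnd_cbnd.
    by apply: eq_integral => x _ /=; rewrite ger0_norm// heat_gauss_ge0// ltW.
  by apply: measurable_funTS; apply: measurableT_comp => //; exact/measurable_EFinP.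
rewrite S2.
under [X in _ = X + _]eq_Rintegral do rewrite mulrBr.
rewrite RintegralB//; last 2 first.
- exact: integrable_L2M.
- by have := integrableZr _ (psi1 0) ig; apply.
rewrite RintegralZr// integral_heat_gauss0// /psi1 oppr0; ring.
Qed.

End weak_form.

(** * Solutions driven by step controls *)

Section step_control.
Context {R : realType}.
Notation mu := (@lebesgue_measure R).

Lemma measurable_heat_rate : measurable_fun setT (@heat_rate R).
Proof.
apply: (measurableT_comp (@measurable_invr R)); apply: measurable_funM => //.
by apply: continuous_measurable_fun; exact: sqrt_continuous.
Qed.

Lemma heat_dipole0w (x : R) : heat_dipole 0 x = 0.
Proof. by rewrite /heat_dipole expr0n/= mulr0 !mul0r. Qed.

Lemma heat_rate0 : heat_rate 0 = 0 :> R.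
Proof. by rewrite /heat_rate sqrtr0 mulr0 invr0. Qed.

(** The tail is the time integral of the dipole, which is nonnegative for [x > 0]. Integrating the
    absolute value of [h] in time first therefore gives [heat_tail] times [|psi|], a product of two
    L2 functions; the blow-up of the L2 norm of the dipole as [s] decreases to [a] does no harm. *)
Lemma time_fubini (a t : R) (psi : R -> R) : a < t -> L2 psi ->
  let k s := \int[mu]_(x in `]0%R, +oo[) (heat_dipole (heat_rate (s - a)) x * psi x) in
  mu.-integrable `[a, t] (EFin \o k) /\
  \int[mu]_(x in `]0%R, +oo[) (heat_tail (heat_rate (t - a)) x * psi x) =
  \int[mu]_(s in `[a, t]) k s.
Proof.
move=> at_ pL k; have mpsi := L2_measurable pL.
have ta : 0 < t - a by rewrite subr_gt0.
pose h (z : R * R) := (if (0 < z.1) && ((a <= z.2) && (z.2 <= t))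
  then heat_dipole (heat_rate (z.2 - a)) z.1 * psi z.1 else 0)%R.
have mh : measurable_fun setT (EFin \o h).
  apply/measurable_EFinP; apply: measurable_fun_ifT => //.
    apply: measurable_and.
      by apply: measurable_fun_ltr => //; exact: measurable_fst.
    apply: measurable_and.
      by apply: measurable_fun_ler => //; exact: measurable_snd.
    by apply: measurable_fun_ler => //; exact: measurable_snd.
  apply: measurable_funM; last by apply: measurableT_comp => //; exact: measurable_fst.
  have mr : measurable_fun setT (fun z : R * R => heat_rate (z.2 - a)).
    apply: (measurableT_comp measurable_heat_rate); apply: measurable_funB => //.
  apply: measurable_funM; last first.
    apply: (measurableT_comp (@measurable_gauss_fun R)); exact: measurable_funM.
  apply: measurable_funM => //; apply: measurable_funM => //.
  exact: measurable_funX.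
have [_ _ /(_ _ (lexx _)) [oL _]] := L2_heat_odd (heat_rate_gt0 ta).
have iE : mu.-integrable `]0%R, +oo[
    (EFin \o (fun x => heat_tail (heat_rate (t - a)) x * psi x)).
  apply: eq_integrable (integrable_L2M (measurable_itv `]0%R, +oo[) oL pL) => // x.
  by rewrite inE/= in_itv/= andbT /heat_odd => ->.
have hk0 s x : a <= s -> 0 < x -> 0 <= heat_dipole (heat_rate (s - a)) x.
  move=> as_ x0; apply: heat_dipole_ge0 (ltW x0).
  by rewrite invr_ge0 mulr_ge0// sqrtr_ge0.
have ik (x : R) : 0 < x -> mu.-integrable `[a, t] (EFin \o (fun s => heat_dipole (heat_rate (s - a)) x)).
  move=> x0; apply/integrableP; split.
    apply: measurable_funTS; apply/measurable_EFinP.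
    have mr : measurable_fun setT (fun s : R => heat_rate (s - a)).
      by apply: (measurableT_comp measurable_heat_rate); apply: measurable_funB.
    apply: measurable_funM; last first.
      by apply: (measurableT_comp (@measurable_gauss_fun R)); apply: measurable_funM.
    by apply: measurable_funM => //; apply: measurable_funM => //; exact: measurable_funX.
  rewrite [ltLHS](_ : _ = (heat_tail (heat_rate (t - a)) x)%:E) ?ltry// -integral_time_heat_dipole//.
  apply: eq_integral => s; rewrite inE/= in_itv/= => /andP[as_ _].
  by rewrite ger0_norm// hk0.
have Is (x c : R) : (\int[mu]_s (if ((0 < x) && ((a <= s) && (s <= t)))%R
      then heat_dipole (heat_rate (s - a)) x * c else 0)%:E =
    (if 0 < x then heat_tail (heat_rate (t - a)) x * c else 0)%:E)%E.
  case: ifPn => x0 /=; last by rewrite integral0_eq.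
  rewrite EFinM -(integral_time_heat_dipole at_ x0) muleC -integralZl//; last exact: ik.
  rewrite [RHS]integral_mkcond; apply: eq_integral => y _.
  by rewrite patchE mem_setE in_itv/=; case: ifP => // _; rewrite -EFinM mulrC.
have ih : (mu \x mu)%E.-integrable setT (EFin \o h).
  apply/integrable12ltyP; first exact: mh.
  have /integrableP[_] := iE; apply: le_lt_trans.
  rewrite [leRHS]integral_mkcond le_eqVlt; apply/orP; left; apply/eqP.
  apply: eq_integral => x _.
  rewrite patchE mem_setE in_itv/= andbT.
  transitivity (\int[mu]_s (if ((0 < x) && ((a <= s) && (s <= t)))%R
      then heat_dipole (heat_rate (s - a)) x * `|psi x| else 0)%:E)%E.
    apply: eq_integral => s _; rewrite /h /=; case: ifP => [/andP[x0 /andP[as_ _]]|_].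
      by rewrite normrM (ger0_norm (hk0 _ _ as_ x0)).
    by rewrite normr0.
  rewrite Is; case: ifPn => // x0 /=.
  by rewrite normrM (ger0_norm (heat_tail_ge0 _ _)).
have kE s : a <= s <= t -> (\int[mu]_x (h (x, s))%:E = (k s)%:E)%E.
  move=> ast; have/andP[as_ _] := ast; rewrite /k /Rintegral fineK; last first.
    apply: integrable_fin_num => //; apply: integrable_L2M => //.
    have [<-|as'] := eqVneq a s.
      have -> : heat_dipole (heat_rate (a - a)) = cst 0.
        by apply/funext => x; rewrite subrr heat_rate0 heat_dipole0w.
      exact: L2_0.
    by apply: L2_heat_dipole; apply: heat_rate_gt0; rewrite subr_gt0 lt_neqAle as'.
  rewrite [RHS]integral_mkcond; apply: eq_integral => x _.
  by rewrite patchE mem_setE in_itv/= andbT /h/= ast andbT; case: ifP.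
have kP s : (\int[mu]_x (h (x, s))%:E = ((EFin \o k) \_ `[a, t]) s)%E.
  rewrite patchE mem_setE in_itv/=; case: ifPn => ast; first exact: kE.
  by apply: integral0_eq => x _; rewrite /h/= (negbTE ast) andbF.
split.
  apply: (integrable_patch _ (measurable_itv _)).2.
  (* The variables are exchanged because [k] is the inner integral over the first variable of [h],
     while the integrability of sections is stated for the second. *)
  have ih' : (mu \x mu)%E.-integrable setT (fun z : R * R => (h (z.2, z.1))%:E).
    apply/integrable12ltyP.
      apply: (measurableT_comp mh (g := fun z : R * R => (z.2, z.1))).
      by apply: measurable_fun_pair; [exact: measurable_snd|exact: measurable_fst].
    by move: ih => /integrable21ltyP; apply; exact: mh.
  have := integrable_fubini_F ih'; congr (_.-integrable _ _).
  by apply/funext => s; rewrite -kP.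
have := Fubini ih => /= FE; rewrite /Rintegral; congr fine.
transitivity (\int[mu]_x \int[mu]_y (h (x, y))%:E)%E.
  rewrite integral_mkcond; apply: eq_integral => x _.
  rewrite patchE mem_setE in_itv/= andbT; rewrite /h /=.
  by rewrite Is; case: ifP.
rewrite FE [RHS]integral_mkcond; apply: eq_integral => s _.
exact: kP.
Qed.

End step_control.

Section step_solution.
Context {R : realType}.
Notation mu := (@lebesgue_measure R).

Definition step_state (a t : R) : R -> R :=
  if t <= a then cst 0 else heat_odd (heat_rate (t - a)).

(* [gauss_tail 0] is the constant value of the control that produces [heat_odd],
   which is not normalized. *)
Definition step_control (a t : R) : R := if t <= a then 0 else gauss_tail 0.

Lemma Htilde0_odd (f : R -> R) : L2 f -> (forall x, f (- x) = - f x) -> Htilde0 f.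
Proof. by move=> fL fo; split => //; exact: eq_ae. Qed.

Lemma heat_rate_le (s t : R) : 0 < s -> s <= t -> heat_rate t <= heat_rate s.
Proof.
move=> s0 st; have t0 := lt_le_trans s0 st.
rewrite lef_pV2 ?posrE ?mulr_gt0 ?sqrtr_gt0// ler_pM2l//.
by rewrite ler_sqrt// ltW.
Qed.

Lemma L2dist0E (f : R -> R) : L2 f -> L2dist f (cst 0) = (L2norm f)%:E.
Proof.
move=> fL; rewrite L2distE//; last exact: L2_0.
by congr (L2norm _)%:E; apply/funext => x /=; rewrite subr0.
Qed.

(** After time [a] the right-hand side tested with [phi] is the dipole pairing [k], by
    [heat_dipole_pairing]; before [a] it is 0. Its time integral is the tested state by
    [time_fubini]. *)
Lemma step_solution (T a : R) : 0 < T -> 0 <= a ->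
  solution T (cst 0) (step_control a) (step_state a).
Proof.
move=> T0 a0.
have [M M0 MP] := L2_heat_odd (heat_rate_gt0 T0).
have WL t : t <= T -> L2 (step_state a t) /\ L2norm (step_state a t) <= M.
  move=> tT; rewrite /step_state; case: leP => [_|ta].
    split; first exact: L2_0.
    apply: L2norm_le => //; first exact: L2_0.
    rewrite integral0_eq ?lee_fin ?sqr_ge0// => x _.
    by rewrite /cst expr0n.
  apply: MP; apply: heat_rate_le; first by rewrite subr_gt0.
  by rewrite (le_trans _ tT)// gerBl.
have Wo t x : step_state a t (- x) = - step_state a t x.
  by rewrite /step_state; case: ifP => _; [rewrite /cst oppr0|exact: heat_odd_opp].
split.
- move=> t; rewrite in_itv/= => /andP[_ tT].
  by apply: Htilde0_odd => //; have [] := WL t tT.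
- exists M => t; rewrite in_itv/= => /andP[_ tT]; have [tL tM] := WL t tT.
  by rewrite L2dist0E// lee_fin.
- by apply: eq_ae => x; rewrite /step_state a0.
- move=> phi; have pL := H2_val_L2 phi.
  pose psi x : R := phi x - phi (- x).
  have psiL : L2 psi by apply: L2B => //; exact: L2_comp_opp.
  pose k s := \int[mu]_(x in `]0%R, +oo[) (heat_dipole (heat_rate (s - a)) x * psi x).
  set B := (X in ac_derivative _ _ _ X).
  (* At [s = a] both sides vanish, the right one because [heat_rate 0 = 0] annihilates the dipole;
     so the case distinction can use the closed condition [a <= s]. *)
  have BE s : B s = if a <= s then k s else 0.
    rewrite /B /step_state /step_control; case: (ltgtP s a) => sa.
    - rewrite mulr0 mul0r subr0 /dxx.
      by rewrite /Rintegral integral0_eq// => x _; rewrite /cst mul0r.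
    - rewrite /k heat_dipole_pairing; last by apply: heat_rate_gt0; rewrite subr_gt0.
      by rewrite /delta'; ring.
    - rewrite sa mulr0 mul0r subr0 /dxx /k subrr heat_rate0.
      rewrite /Rintegral integral0_eq; last by move=> x _; rewrite /cst mul0r.
      by rewrite integral0_eq// => x _; rewrite heat_dipole0w mul0r.
  have patchB (t : R) : 0 <= t -> (EFin \o B) \_ `[0%R, t] = (EFin \o k) \_ `[a, t].
    move=> t0; apply/funext => s; rewrite !patchE !mem_setE !in_itv/= BE.
    case: (leP a s) => as_; first by rewrite (le_trans a0 as_).
    by case: ifP.
  have ik (t : R) : 0 <= t -> mu.-integrable `[a, t] (EFin \o k).
    move=> t0; have [ta|at_] := leP t a.
      have [ta'|ta'] := eqVneq t a.
        rewrite ta' set_itv1; apply/integrableP; split.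
          apply/measurable_EFinP; exact: measurable_fun_set1.
        by rewrite integral_set1.
      rewrite set_itv_ge ?bnd_simp -?ltNge ?lt_neqAle ?ta'//.
      apply/integrableP; split; first exact: measurable_fun_set0.
      by rewrite integral_set0.
    by have [] := time_fubini at_ psiL.
  have A0 t : t <= a -> L2_to_Hm2 (step_state a t) phi = 0.
    move=> ta; rewrite /step_state ta /L2_to_Hm2 /Rintegral integral0_eq// => x _.
    by rewrite /cst mul0r.
  split.
    apply: (integrable_patch _ (measurable_itv _)).2.
    rewrite patchB; last exact: ltW.
    exact: (integrable_patch _ (measurable_itv _)).1 (ik _ (ltW T0)).
  move=> t; rewrite in_itv/= => /andP[t0 tT].
  have -> := A0 0 a0; rewrite add0r.
  have -> : \int[mu]_(y in `[0%R, t]) B y = \int[mu]_(y in `[a, t]) k y.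
    rewrite /Rintegral integral_mkcond [in RHS]integral_mkcond; congr fine.
    by congr (integral _ _ _); exact: patchB.
  have [ta|at_] := leP t a.
    rewrite A0//; have [ta'|ta'] := eqVneq t a.
      by rewrite ta' set_itv1 Rintegral_set1.
    by rewrite set_itv_ge ?Rintegral_set0// bnd_simp -ltNge lt_neqAle ta'.
  have [_ <-] := time_fubini at_ psiL.
  have ta : (t <= a) = false by rewrite leNgt at_.
  have := WL t tT; rewrite /step_state ta => -[oL _].
  rewrite /L2_to_Hm2 odd_pairing//; last by move=> x; exact: heat_odd_opp.
  apply: eq_Rintegral => x; rewrite inE/= in_itv/= andbT /heat_odd => ->.
  by [].
Qed.

(** The shape [c * _ + _] provides linear spans of states and, at [c = -1], the difference of two
    solutions. *)
Lemma solution_lin (T c : R) (f1 f2 u1 u2 : R -> R) (W1 W2 : R -> R -> R) :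
  0 <= T ->
  solution T f1 u1 W1 -> solution T f2 u2 W2 ->
  solution T (fun x => c * f1 x + f2 x) (fun t => c * u1 t + u2 t)
    (fun t x => c * W1 t x + W2 t x).
Proof.
move=> T0 [H1 [M1 B1] I1 D1] [H2 [M2 B2] I2 D2].
have L1 t : t \in `[0, T] -> L2 (W1 t) by move=> /H1[].
have L2_ t : t \in `[0, T] -> L2 (W2 t) by move=> /H2[].
have L12 t : t \in `[0, T] -> L2 (fun x => c * W1 t x + W2 t x).
  by move=> tT; apply: L2D (L2Z _ (L1 t tT)) (L2_ t tT).
split.
- move=> t tT; split; first exact: L12.
  have [_ o1] := H1 t tT; have [_ o2] := H2 t tT.
  apply: ae_impl2 o1 o2 => x /(_ I) -> /(_ I) -> _; ring.
- exists (`|c| * M1 + M2) => t tT.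
  rewrite L2dist0E; last exact: L12.
  have := B1 t tT; have := B2 t tT.
  rewrite !L2dist0E; [|exact: L1|exact: L2_].
  rewrite !lee_fin => b2 b1.
  apply: (le_trans (L2normD (L2Z c (L1 t tT)) (L2_ t tT))).
  by rewrite L2normZ ?lerD// ?ler_wpM2l//; exact: L1.
- by apply: ae_impl2 I1 I2 => x /(_ I) -> /(_ I) ->.
- move=> phi; have [i1 e1] := D1 phi; have [i2 e2] := D2 phi.
  have pairE (g : R -> R) t : t \in `[0, T] -> L2 g ->
      \int[mu]_x ((c * W1 t x + W2 t x) * g x) =
      c * \int[mu]_x (W1 t x * g x) + \int[mu]_x (W2 t x * g x).
    move=> tT gL.
    have j1 := L2_integrableM (L1 t tT) gL; have j2 := L2_integrableM (L2_ t tT) gL.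
    rewrite -RintegralZl// -RintegralD//; last by have := integrableZl _ c j1; apply.
    by apply: eq_Rintegral => x _; ring.
  have T0T : 0 \in `[0, T] by rewrite in_itv/= lexx.
  set b1 := (fun t => dxx (W1 t) phi - _) in i1 e1.
  set b2 := (fun t => dxx (W2 t) phi - _) in i2 e2.
  set b := (X in ac_derivative _ _ _ X).
  have bE t : t \in `[0, T] -> b t = c * b1 t + b2 t.
    move=> tT; rewrite /b /dxx pairE//; last exact: H2_d2_L2.
    by rewrite /b1 /b2 /dxx; ring.
  have i1c : mu.-integrable `[0, T] (EFin \o (fun t => c * b1 t)).
    by have := integrableZl _ c i1; apply.
  have i12 : mu.-integrable `[0, T] (EFin \o (fun t => c * b1 t + b2 t)).
    by have := integrableD _ i1c i2; apply.
  split.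
    apply: eq_integrable i12 => // t; rewrite inE/= => tT.
    by rewrite bE.
  move=> t tT; have tT' := tT; rewrite in_itv/= in tT'.
  have sub : `[0, t] `<=` `[0, T].
    by apply: subset_itvl; rewrite bnd_simp; case/andP: tT'.
  rewrite /L2_to_Hm2 !pairE//; try exact: H2_val_L2.
  rewrite -/(L2_to_Hm2 (W1 t) phi) -/(L2_to_Hm2 (W2 t) phi) e1// e2//.
  have -> : \int[mu]_(y in `[0, t]) b y = \int[mu]_(y in `[0, t]) (c * b1 y + b2 y).
    by apply: eq_Rintegral => y; rewrite inE/= => /sub yT; exact: bE.
  have s1 : mu.-integrable `[0, t] (EFin \o b1) by apply: integrableS i1.
  have s1c : mu.-integrable `[0, t] (EFin \o (fun t => c * b1 t)) by apply: integrableS i1c.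
  have s2 : mu.-integrable `[0, t] (EFin \o b2) by apply: integrableS i2.
  have -> : \int[mu]_(y in `[0, t]) (c * b1 y + b2 y) =
      c * \int[mu]_(y in `[0, t]) b1 y + \int[mu]_(y in `[0, t]) b2 y.
    by rewrite (RintegralD _ s1c s2)// (RintegralZl _ _ s1).
  by rewrite /L2_to_Hm2; ring.
Qed.

Lemma bounded_Linfty (T M : R) (u : R -> R) : measurable_fun setT u ->
  (forall t, `|u t| <= M) -> Linfty T u.
Proof.
move=> mu_ uM; rewrite /Linfty/= inE; apply/andP; split.
  rewrite inE/=; apply/measurable_restrict => //; exact: measurable_funTS.
rewrite inE/= /finite_norm unlock /Lnorm.
case: ifPn => // _.
(* Outside []0, T[] the restricted control takes the default value [point], which the bound has to
   cover too. *)
apply: (@le_lt_trans _ _ (Num.max M `|point : R|)%:E); last exact: ltry.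
apply/ess_sup_inf.ess_supP; apply: aeW => x /=; rewrite patchE.
by case: ifP => _; rewrite lee_fin le_max ?uM// lexx orbT.
Qed.

End step_solution.

(** * Uniqueness *)

Section test_functions.
Context {R : realType}.
Notation mu := (@lebesgue_measure R).
Implicit Types (p w s x : R).

Lemma ac_derivative_C1 (f g : R -> R) : (forall x : R, is_derive x 1 f (g x)) ->
  continuous g -> forall a b : R, a <= b -> ac_derivative a b f g.
Proof.
move=> df cg a b ab.
have cf := is_derive_continuous df.
split.
  apply: continuous_compact_integrable; first exact: segment_compact.
  exact: continuous_subspaceT.
move=> x; rewrite in_itv/= => /andP[ax xb].
have [<-|ax'] := eqVneq a x; first by rewrite set_itv1 Rintegral_set1 addr0.
have {}ax : a < x by rewrite lt_neqAle ax'.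
rewrite /Rintegral (@continuous_FTC2 _ g f).
- by rewrite -EFinB/= subrKC.
- exact: ax.
- exact: continuous_subspaceT.
- split.
  + by move=> y _; have [] := df y.
  + by apply: cvg_at_right_filter; exact: cf.
  + by apply: cvg_at_left_filter; exact: cf.
- by move=> y _; rewrite derive1E; have [_] := df y.
Qed.

(** Four derivatives are listed because [xgauss2] is to be an element of [H2] as well as [xgauss]:
    the pairing with the dipole will be differentiated twice along a solution. *)
Definition xgauss p x := x * expR (- (p * x ^+ 2)).
Definition xgauss1 p x := (1 - 2 * p * x ^+ 2) * expR (- (p * x ^+ 2)).
Definition xgauss2 p x := (- (6 * p) * x + 4 * p ^+ 2 * x ^+ 3) * expR (- (p * x ^+ 2)).
Definition xgauss3 p x := (- (6 * p) + 24 * p ^+ 2 * x ^+ 2 - 8 * p ^+ 3 * x ^+ 4)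
  * expR (- (p * x ^+ 2)).
Definition xgauss4 p x := (60 * p ^+ 2 * x - 80 * p ^+ 3 * x ^+ 3 + 16 * p ^+ 4 * x ^+ 5)
  * expR (- (p * x ^+ 2)).

Lemma is_derive_xgauss p x : is_derive x 1 (xgauss p) (xgauss1 p x).
Proof.
have dg := is_derive_gauss p x.
by apply: is_derive_eq; rewrite /GRing.scale/= /xgauss1; ring.
Qed.

Lemma is_derive_xgauss1 p x : is_derive x 1 (xgauss1 p) (xgauss2 p x).
Proof.
have dg := is_derive_gauss p x.
by apply: is_derive_eq; rewrite /GRing.scale/= /xgauss2; ring.
Qed.

Lemma is_derive_xgauss2 p x : is_derive x 1 (xgauss2 p) (xgauss3 p x).
Proof.
have dg := is_derive_gauss p x.
by apply: is_derive_eq; rewrite /GRing.scale/= /xgauss3; ring.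
Qed.

Lemma is_derive_xgauss3 p x : is_derive x 1 (xgauss3 p) (xgauss4 p x).
Proof.
have dg := is_derive_gauss p x.
by apply: is_derive_eq; rewrite /GRing.scale/= /xgauss4; ring.
Qed.

Lemma normX_le x n : (n <= 6)%N -> `|x| ^+ n <= (1 + x ^+ 2) ^+ 3.
Proof.
move=> n6; have x2 : 0 <= x ^+ 2 by exact: sqr_ge0.
have [x1|x1] := leP `|x| 1.
  rewrite (@le_trans _ _ 1)//; first by rewrite exprn_ile1.
  by rewrite exprn_ege1// lerDl.
apply: (@le_trans _ _ (`|x| ^+ 6)); first by rewrite ler_eXn2l.
rewrite (_ : `|x| ^+ 6 = (x ^+ 2) ^+ 3); last first.
  by rewrite -(real_normK (num_real x)) -exprM.
by rewrite ler_pXn2r// ?nnegrE ?addr_ge0// lerDr.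
Qed.

Lemma continuous_gaussM (f : R -> R) p : continuous f ->
  continuous (fun x => f x * expR (- (p * x ^+ 2))).
Proof. by move=> cf x; apply: cvgM; [exact: cf|exact: continuous_gauss]. Qed.

Lemma trinomial_le c0 c1 c2 (n0 n1 n2 : nat) x :
  (n0 <= 6)%N -> (n1 <= 6)%N -> (n2 <= 6)%N ->
  `|c0 * x ^+ n0 + c1 * x ^+ n1 + c2 * x ^+ n2| <=
  (`|c0| + `|c1| + `|c2|) * (1 + x ^+ 2) ^+ 3.
Proof.
move=> h0 h1 h2; rewrite !mulrDl.
have H c n : (n <= 6)%N -> `|c * x ^+ n| <= `|c| * (1 + x ^+ 2) ^+ 3.
  by move=> n6; rewrite normrM normrX ler_wpM2l// normX_le.
by rewrite (le_trans (ler_normD _ _))// lerD ?H// (le_trans (ler_normD _ _))// lerD ?H.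
Qed.

(** Three monomials suffice for [xgauss] and its four derivatives; missing ones get the coefficient
    0. Degrees up to 6 share the weight [(1 + x ^+ 2) ^+ 3]. *)
Lemma trinomial_gauss_L2 p c0 c1 c2 (n0 n1 n2 : nat) : 0 < p ->
  (n0 <= 6)%N -> (n1 <= 6)%N -> (n2 <= 6)%N ->
  L2 (fun x => (c0 * x ^+ n0 + c1 * x ^+ n1 + c2 * x ^+ n2) * expR (- (p * x ^+ 2))).
Proof.
move=> p0 h0 h1 h2; have [K K0 KP] := L2_gauss_dominated 3 p0.
have cX n : continuous (fun x : R => x ^+ n) by exact: exprn_continuous.
have [] // := KP (`|c0| + `|c1| + `|c2|) (fun x =>
    (c0 * x ^+ n0 + c1 * x ^+ n1 + c2 * x ^+ n2) * expR (- (p * x ^+ 2))).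
  apply: continuous_measurable_fun; apply: continuous_gaussM => x.
  by apply: cvgD; [apply: cvgD|]; apply: cvgM; (exact: cvg_cst || exact: cX).
move=> x; rewrite normrM (ger0_norm (expR_ge0 _)) mulrA ler_wpM2r ?expR_ge0//.
exact: trinomial_le.
Qed.

Lemma L2_xgauss p : 0 < p -> L2 (xgauss p).
Proof.
move=> p0; have -> : xgauss p = (fun x => (1 * x ^+ 1 + 0 * x ^+ 0 + 0 * x ^+ 0) * expR (- (p * x ^+ 2))).
  by apply/funext => x; rewrite /xgauss; ring.
exact: trinomial_gauss_L2.
Qed.

Lemma L2_xgauss1 p : 0 < p -> L2 (xgauss1 p).
Proof.
move=> p0; have -> : xgauss1 p = (fun x =>
    (1 * x ^+ 0 + (- (2 * p)) * x ^+ 2 + 0 * x ^+ 0) * expR (- (p * x ^+ 2))).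
  by apply/funext => x; rewrite /xgauss1; ring.
exact: trinomial_gauss_L2.
Qed.

Lemma L2_xgauss2 p : 0 < p -> L2 (xgauss2 p).
Proof.
move=> p0; have -> : xgauss2 p = (fun x =>
    (- (6 * p) * x ^+ 1 + 4 * p ^+ 2 * x ^+ 3 + 0 * x ^+ 0) * expR (- (p * x ^+ 2))).
  by apply/funext => x; rewrite /xgauss2; ring.
exact: trinomial_gauss_L2.
Qed.

Lemma L2_xgauss3 p : 0 < p -> L2 (xgauss3 p).
Proof.
move=> p0; have -> : xgauss3 p = (fun x =>
    (- (6 * p) * x ^+ 0 + 24 * p ^+ 2 * x ^+ 2 + (- (8 * p ^+ 3)) * x ^+ 4) *
    expR (- (p * x ^+ 2))).
  by apply/funext => x; rewrite /xgauss3; ring.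
exact: trinomial_gauss_L2.
Qed.

Lemma L2_xgauss4 p : 0 < p -> L2 (xgauss4 p).
Proof.
move=> p0; have -> : xgauss4 p = (fun x =>
    (60 * p ^+ 2 * x ^+ 1 + (- (80 * p ^+ 3)) * x ^+ 3 + 16 * p ^+ 4 * x ^+ 5) *
    expR (- (p * x ^+ 2))).
  by apply/funext => x; rewrite /xgauss4; ring.
exact: trinomial_gauss_L2.
Qed.

Lemma continuous_xgauss4 p : continuous (xgauss4 p).
Proof.
move=> x; apply: cvgM; last exact: continuous_gauss.
have cX n : continuous (fun x : R => x ^+ n) by exact: exprn_continuous.
apply: cvgD; last by apply: cvgM; [exact: cvg_cst|exact: cX].
apply: cvgB; first by apply: cvgM; [exact: cvg_cst|exact: cvg_id].
by apply: cvgM; [exact: cvg_cst|exact: cX].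
Qed.

Definition xgauss_H2 p (p0 : 0 < p) : H2 := MkH2 (L2_xgauss p0) (L2_xgauss1 p0) (L2_xgauss2 p0)
  (ac_derivative_C1 (is_derive_xgauss p) (is_derive_continuous (is_derive_xgauss1 p)))
  (ac_derivative_C1 (is_derive_xgauss1 p) (is_derive_continuous (is_derive_xgauss2 p))).

Definition xgauss2_H2 p (p0 : 0 < p) : H2 := MkH2 (L2_xgauss2 p0) (L2_xgauss3 p0) (L2_xgauss4 p0)
  (ac_derivative_C1 (is_derive_xgauss2 p) (is_derive_continuous (is_derive_xgauss3 p)))
  (ac_derivative_C1 (is_derive_xgauss3 p) (@continuous_xgauss4 p)).

(** The dipole solves the heat equation, so its first and second time derivatives are its second and
    fourth space derivatives. In this form they appear in the duality with [H2]. *)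
Definition heat_dipole_t w x := 2 * w ^+ 3 * xgauss2 (w ^+ 2) x.
Definition heat_dipole_tt w x := 2 * w ^+ 3 * xgauss4 (w ^+ 2) x.

Lemma heat_dipoleE w x : heat_dipole w x = 2 * w ^+ 3 * xgauss (w ^+ 2) x.
Proof. by rewrite /heat_dipole /xgauss /gauss_fun exprMn mulrA. Qed.

Lemma is_derive_time_gauss s x : 0 < s ->
  is_derive s 1 (fun s => expR (- (heat_rate s ^+ 2 * x ^+ 2)))
    (4 * heat_rate s ^+ 4 * x ^+ 2 * expR (- (heat_rate s ^+ 2 * x ^+ 2))).
Proof.
move=> s0; have dr := is_derive_heat_rate s0.
have H : is_derive s 1 (fun s => - (heat_rate s ^+ 2 * x ^+ 2)) (4 * heat_rate s ^+ 4 * x ^+ 2).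
  by apply: is_derive_eq; rewrite /GRing.scale/=; ring.
have := @is_derive1_comp R expR (fun s => - (heat_rate s ^+ 2 * x ^+ 2)) s _ _ (is_derive_expR _) H.
by rewrite mulrC.
Qed.

Lemma is_derive_time_heat_dipole s x : 0 < s ->
  is_derive s 1 (fun s => heat_dipole (heat_rate s) x) (heat_dipole_t (heat_rate s) x).
Proof.
move=> s0; have dr := is_derive_heat_rate s0.
have dg := is_derive_time_gauss x s0.
under eq_fun do rewrite heat_dipoleE /xgauss.
by apply: is_derive_eq; rewrite /GRing.scale/= /heat_dipole_t /xgauss2; ring.
Qed.

Lemma is_derive_time_heat_dipole_t s x : 0 < s ->
  is_derive s 1 (fun s => heat_dipole_t (heat_rate s) x) (heat_dipole_tt (heat_rate s) x).
Proof.
move=> s0; have dr := is_derive_heat_rate s0.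
have dg := is_derive_time_gauss x s0.
rewrite /heat_dipole_t /xgauss2.
by apply: is_derive_eq; rewrite /GRing.scale/= /heat_dipole_tt /xgauss4; ring.
Qed.

Lemma heat_dipole_time_bounds w1 w2 : 0 < w1 -> w1 <= w2 -> exists2 C : R, 0 <= C & forall w x,
  w1 <= w -> w <= w2 ->
  `|heat_dipole_t w x| <= C * ((1 + x ^+ 2) ^+ 3 * expR (- (w1 ^+ 2 * x ^+ 2))) /\
  `|heat_dipole_tt w x| <= C * ((1 + x ^+ 2) ^+ 3 * expR (- (w1 ^+ 2 * x ^+ 2))).
Proof.
move=> w10 w12; have w20 := lt_le_trans w10 w12.
(* [A1] and [A2] are the sums of the absolute values of the coefficients of [xgauss2] and [xgauss4]
   at [p = w2 ^+ 2], where these are largest; the Gaussian is largest at the other end, [w1]. *)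
pose A1 : R := 6 * w2 ^+ 2 + 4 * w2 ^+ 4.
pose A2 : R := 60 * w2 ^+ 4 + 80 * w2 ^+ 6 + 16 * w2 ^+ 8.
have X0 n : 0 <= w2 ^+ n by rewrite exprn_ge0// ltW.
have A10 : 0 <= A1 by rewrite /A1 addr_ge0// mulr_ge0.
have A20 : 0 <= A2 by rewrite /A2 !addr_ge0// mulr_ge0.
have main (f : R -> R) w x A : w1 <= w -> w <= w2 -> A <= A1 + A2 ->
    `|f x| <= A * (1 + x ^+ 2) ^+ 3 ->
    `|2 * w ^+ 3 * (f x * expR (- (w ^+ 2 * x ^+ 2)))| <=
    (2 * w2 ^+ 3 * (A1 + A2)) * ((1 + x ^+ 2) ^+ 3 * expR (- (w1 ^+ 2 * x ^+ 2))).
  move=> ww1 ww2 AA fA; have w0 := lt_le_trans w10 ww1.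
  rewrite normrM (ger0_norm (x := 2 * w ^+ 3)); last first.
    by rewrite mulr_ge0// exprn_ge0// ltW.
  rewrite normrM (ger0_norm (expR_ge0 _)) -mulrA ler_pM//.
  - by rewrite mulr_ge0// exprn_ge0// ltW.
  - by rewrite ler_wpM2l// ler_pXn2r// nnegrE ltW.
  rewrite mulrA ler_pM ?expR_ge0//.
    by rewrite (le_trans fA)// ler_wpM2r// exprn_ge0// addr_ge0// sqr_ge0.
  by rewrite ler_expR lerN2 ler_wpM2r ?sqr_ge0// ler_pXn2r// nnegrE ltW.
exists (2 * w2 ^+ 3 * (A1 + A2)); first exact: (mulr_ge0 (mulr_ge0 (ler0n R 2) (X0 3)) (addr_ge0 A10 A20)).
move=> w x ww1 ww2; have w0 := lt_le_trans w10 ww1.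
have Xw n : w ^+ n <= w2 ^+ n by apply: lerXn2r => //; rewrite nnegrE ltW.
have Xw0 n : 0 <= w ^+ n by rewrite exprn_ge0// ltW.
have X3 : 0 <= (1 + x ^+ 2) ^+ 3 by rewrite exprn_ge0// addr_ge0// sqr_ge0.
have nc c n : 0 <= c -> `|c * w ^+ n| <= c * w2 ^+ n.
  by move=> c0; rewrite ger0_norm ?mulr_ge0// ler_wpM2l.
have nNc c n : 0 <= c -> `|- (c * w ^+ n)| <= c * w2 ^+ n.
  by move=> c0; rewrite normrN nc.
split.
- apply: (main (fun x => - (6 * w ^+ 2) * x + 4 * (w ^+ 2) ^+ 2 * x ^+ 3) w x A1 ww1 ww2).
  + by rewrite lerDl A20.
  + have := @trinomial_le (- (6 * w ^+ 2)) (4 * w ^+ 4) 0 1 3 0 x isT isT isT.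
    rewrite mul0r addr0 expr1 -exprM => /le_trans; apply; rewrite ler_wpM2r//.
    by rewrite normr0 addr0 lerD// ?nNc// nc.
- apply: (main (fun x => 60 * (w ^+ 2) ^+ 2 * x - 80 * (w ^+ 2) ^+ 3 * x ^+ 3 +
    16 * (w ^+ 2) ^+ 4 * x ^+ 5) w x A2 ww1 ww2).
  + by rewrite lerDr A10.
  + have := @trinomial_le (60 * w ^+ 4) (- (80 * w ^+ 6)) (16 * w ^+ 8) 1 3 5 x isT isT isT.
    rewrite expr1 -!exprM mulNr => /le_trans; apply; rewrite ler_wpM2r//.
    by rewrite !lerD// ?nNc// nc.
Qed.

End test_functions.

Section uniqueness.
Context {R : realType}.
Notation mu := (@lebesgue_measure R).

Lemma lebesgue_measure_cc (r t : R) : r <= t -> mu `[r, t]%classic = (t - r)%:E.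
Proof.
move=> rt; rewrite lebesgue_measure_itv/= lte_fin lt_neqAle rt andbT.
by have [->|_] := eqVneq r t; rewrite ?subrr// -EFinB.
Qed.

Lemma Rintegral_itv_cst (r t B : R) : r <= t ->
  \int[mu]_(_ in `[r, t]) B = B * (t - r).
Proof.
move=> rt; rewrite Rintegral_cst//; congr (_ * _).
exact: (congr1 fine (lebesgue_measure_cc rt)).
Qed.

Lemma Rintegral_itv_le (f : R -> R) (r t B : R) : r <= t ->
  mu.-integrable `[r, t] (EFin \o f) -> (forall s, r <= s <= t -> `|f s| <= B) ->
  `|\int[mu]_(s in `[r, t]) f s| <= B * (t - r).
Proof.
move=> rt iF fB.
apply: (le_trans (le_normr_Rintegral _ iF)) => //.
apply: (@le_trans _ _ (\int[mu]_(s in `[r, t]) B)).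
  apply: le_Rintegral => //.
  - by have := integrable_norm iF; apply.
  - apply/integrableP; split; first exact: measurable_cst.
    by rewrite integral_cst//= [X in (_ * X)%E](lebesgue_measure_cc rt) -EFinM ltry.
by rewrite Rintegral_itv_cst.
Qed.

Lemma ac_increment (T : R) (f g : R -> R) (r t : R) : ac_derivative 0 T f g ->
  0 <= r -> r <= t -> t <= T ->
  mu.-integrable `[r, t] (EFin \o g) /\ f t - f r = \int[mu]_(s in `[r, t]) g s.
Proof.
move=> [ig fE] r0 rt tT.
have i0t : mu.-integrable `[0, t] (EFin \o g).
  by apply: integrableS ig => //; apply: subset_itvl; rewrite bnd_simp.
have irt : mu.-integrable `[r, t] (EFin \o g).
  by apply: integrableS i0t => //; apply: subset_itvr; rewrite bnd_simp.
split=> //.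
rewrite (fE t) ?(fE r) ?in_itv/= ?r0 ?(le_trans rt)// ?(le_trans r0)//.
rewrite opprD addrACA subrr add0r Rintegral_itvB//.
by rewrite Rintegral_itv_obnd_cbnd//; apply: integrableS irt => //; exact: subset_itv_oc_cc.
Qed.

Lemma pairing_ae0 (f g : R -> R) : L2 f -> L2 g -> f = cst 0 %[ae mu] ->
  \int[mu]_x (f x * g x) = 0.
Proof.
move=> fL gL f0; rewrite /Rintegral (ae_eq_integral (cst 0%E))//.
- by rewrite integral0.
- exact: (measurable_int _ (L2_integrableM fL gL)).
- by apply: ae_impl f0 => x /(_ I) -> _; rewrite /cst mul0r.
Qed.

(* With [k_s = heat_dipole (heat_rate s)], the derivative of [y |-> <V y, k_(sg - y)>]
   is [<V y, k''_(sg - y)> - <V y, k''_(sg - y)> = 0]. As [V] is only weakly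
   absolutely continuous, this is phrased as a quadratic bound on increments. *)
Lemma null_solution_pairing (T : R) (V : R -> R -> R) (t s0 : R) : 0 <= T ->
  solution T (cst 0) (cst 0) V -> 0 <= t -> t <= T -> 0 < s0 ->
  \int[mu]_x (V t x * heat_dipole (heat_rate s0) x) = 0.
Proof.
move=> T0 [HV [M HM] V0 Vac] t0 tT s00.
have VL y : 0 <= y -> y <= t -> L2 (V y).
  by move=> y0 yt; have [] := HV y; rewrite ?in_itv/= ?y0 ?(le_trans yt).
have VM y : 0 <= y -> y <= t -> L2norm (V y) <= M.
  move=> y0 yt; have := HM y; rewrite in_itv/= y0 (le_trans yt)// L2dist0E//; last exact: VL.
  by rewrite lee_fin; apply.
have M0 : 0 <= M by rewrite (le_trans (L2norm_ge0 _) (VM 0 _ _)).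
pose P y s := \int[mu]_x (V y x * heat_dipole (heat_rate s) x).
pose P1 y s := \int[mu]_x (V y x * heat_dipole_t (heat_rate s) x).
pose P2 y s := \int[mu]_x (V y x * heat_dipole_tt (heat_rate s) x).
have hkL (s : R) : 0 < s -> [/\ L2 (heat_dipole (heat_rate s)),
    L2 (heat_dipole_t (heat_rate s)) & L2 (heat_dipole_tt (heat_rate s))].
  move=> /heat_rate_gt0 r0; have r2 : 0 < heat_rate s ^+ 2 by rewrite exprn_gt0.
  by split; [exact: L2_heat_dipole|exact: L2Z (L2_xgauss2 r2)|exact: L2Z (L2_xgauss4 r2)].
have scale (c : R) (G : R -> R) y : L2 (V y) -> L2 G ->
    \int[mu]_x (V y x * (c * G x)) = c * \int[mu]_x (V y x * G x).
  move=> yL GL; rewrite -RintegralZl//; last exact: L2_integrableM.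
  by apply: eq_Rintegral => x _; ring.
(* Common source of [PE] and [P1E], with [phi] taken as [xgauss] and as [xgauss2]. The control is
   zero, so the [delta'] term disappears. *)
have PV (phi : H2) (c x y : R) : 0 <= x -> x <= y -> y <= t ->
    mu.-integrable `[x, y] (EFin \o (fun r => \int[mu]_z (V r z * (c * H2_d2 phi z)))) /\
    \int[mu]_z (V y z * (c * phi z)) - \int[mu]_z (V x z * (c * phi z)) =
    \int[mu]_(r in `[x, y]) \int[mu]_z (V r z * (c * H2_d2 phi z)).
  move=> x0 xy yt; have [i e] := ac_increment (Vac phi) x0 xy (le_trans yt tT).
  have pL := H2_val_L2 phi; have p2L := H2_d2_L2 phi.
  have E r : r \in `[x, y]%classic -> \int[mu]_z (V r z * (c * H2_d2 phi z)) =
      c * (dxx (V r) phi - 2 * (cst 0 r) * delta' phi).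
    rewrite inE/= in_itv/= => /andP[xr ry].
    rewrite scale//; first by rewrite /dxx /=; ring.
    by apply: VL; [exact: le_trans xr|exact: le_trans yt].
  split.
    have := integrableZl _ c i => /(_ (measurable_itv _)).
    by apply: eq_integrable => // r rxy /=; rewrite E.
  have -> : \int[mu]_(r in `[x, y]) (\int[mu]_z (V r z * (c * H2_d2 phi z))) =
      c * (L2_to_Hm2 (V y) phi - L2_to_Hm2 (V x) phi).
    by rewrite e -RintegralZl//; apply: eq_Rintegral => r rxy; exact: E.
  rewrite !scale//; first by rewrite /L2_to_Hm2; ring.
  - by apply: VL => //; exact: le_trans yt.
  - by apply: VL => //; exact: le_trans xy.
have PE s x y : 0 < s -> 0 <= x -> x <= y -> y <= t ->
    mu.-integrable `[x, y] (EFin \o (fun r => P1 r s)) /\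
    P y s - P x s = \int[mu]_(r in `[x, y]) P1 r s.
  move=> /heat_rate_gt0 r0 x0 xy yt; have r2 : 0 < heat_rate s ^+ 2 by rewrite exprn_gt0.
  have := @PV (xgauss_H2 r2) (2 * heat_rate s ^+ 3) x y x0 xy yt.
  rewrite /P /P1 /heat_dipole_t /=.
  have -> // : heat_dipole (heat_rate s) =
      fun z => 2 * heat_rate s ^+ 3 * xgauss (heat_rate s ^+ 2) z.
  by apply/funext => z; rewrite heat_dipoleE.
have P1E s x y : 0 < s -> 0 <= x -> x <= y -> y <= t ->
    mu.-integrable `[x, y] (EFin \o (fun r => P2 r s)) /\
    P1 y s - P1 x s = \int[mu]_(r in `[x, y]) P2 r s.
  move=> /heat_rate_gt0 r0 x0 xy yt; have r2 : 0 < heat_rate s ^+ 2 by rewrite exprn_gt0.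
  exact: (@PV (xgauss2_H2 r2) (2 * heat_rate s ^+ 3) x y x0 xy yt).
(* The test function at time [y] has age [sg - y], which falls from [sg] to [s0] while [y] runs from
   0 to [t]. It stays away from age 0, where the dipole is singular. *)
pose sg := s0 + t.
have sg0 : 0 < sg by rewrite ltr_pwDl.
have w10 : 0 < heat_rate sg := heat_rate_gt0 sg0.
have w12 : heat_rate sg <= heat_rate s0 by apply: heat_rate_le => //; rewrite lerDl.
have [C C0 HC] := heat_dipole_time_bounds w10 w12.
have HCs s x : s0 <= s -> s <= sg ->
    `|heat_dipole_tt (heat_rate s) x| <= C * ((1 + x ^+ 2) ^+ 3 * expR (- (heat_rate sg ^+ 2 * x ^+ 2))).
  move=> s0s ssg; have [] // := HC (heat_rate s) x.
    by apply: heat_rate_le => //; exact: lt_le_trans s0s.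
  by apply: heat_rate_le.
have w12' : 0 < heat_rate sg ^+ 2 by rewrite exprn_gt0.
have [K K0 HK] := L2_gauss_dominated 3 w12'.
have P2M s y : s0 <= s -> s <= sg -> 0 <= y -> y <= t -> `|P2 y s| <= M * (C * K).
  move=> s0s ssg y0 yt; have [_ _ L] := hkL s (lt_le_trans s00 s0s).
  apply: (le_trans (cauchy_schwarz (VL y y0 yt) L)).
  rewrite ler_pM ?L2norm_ge0 ?VM//.
  have [] // := HK C (heat_dipole_tt (heat_rate s)); first exact: L2_measurable.
  by move=> x; exact: HCs.
(* Expansion in the time of [V] with the age frozen: the derivative [P1] is itself Lipschitz in
   time, by [P1E] and the bound on [P2]. *)
have step_t s x y : s0 <= s -> s <= sg -> 0 <= x -> x <= y -> y <= t ->
    `|P y s - P x s - (y - x) * P1 x s| <= M * (C * K) * (y - x) ^+ 2.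
  move=> s0s ssg x0 xy yt; have s_gt0 := lt_le_trans s00 s0s.
  have [i ->] := PE s x y s_gt0 x0 xy yt.
  have ic : mu.-integrable `[x, y] (EFin \o (fun=> P1 x s)).
    apply: continuous_compact_integrable; first exact: segment_compact.
    by apply: continuous_subspaceT; exact: cst_continuous.
  have -> : \int[mu]_(r in `[x, y]) P1 r s - (y - x) * P1 x s =
      \int[mu]_(r in `[x, y]) (P1 r s - P1 x s).
    by rewrite RintegralB// Rintegral_itv_cst// mulrC.
  have -> : M * (C * K) * (y - x) ^+ 2 = M * (C * K) * (y - x) * (y - x) by ring.
  apply: Rintegral_itv_le => //.
    by have := integrableB _ i ic; apply.
  move=> r /andP[xr ry].
  have [i2 ->] := P1E s x r s_gt0 x0 xr (le_trans ry yt).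
  apply: (le_trans (Rintegral_itv_le xr i2 (B := M * (C * K)) _)).
    move=> q /andP[xq qr]; apply: P2M => //; first exact: le_trans xq.
    by rewrite (le_trans qr)// (le_trans ry).
  by rewrite ler_wpM2l ?mulr_ge0// lerD2r.
(* Expansion in the age with [V] frozen. Its linear coefficient is the same [P1], by the heat
   equation for the dipole. *)
have step_s s s' x : s0 <= s -> s <= s' -> s' <= sg -> 0 <= x -> x <= t ->
    `|P x s' - P x s - (s' - s) * P1 x s| <= M * (C * K) * (s' - s) ^+ 2.
  move=> s0s ss' s'sg x0 xt; have s_gt0 := lt_le_trans s00 s0s.
  have [L0 L1 _] := hkL s s_gt0; have [L0' _ _] := hkL s' (lt_le_trans s_gt0 ss').
  have xL := VL x x0 xt.
  pose D z := heat_dipole (heat_rate s') z - heat_dipole (heat_rate s) z -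
    (s' - s) * heat_dipole_t (heat_rate s) z.
  have DL : L2 D by apply: L2B (L2B L0' L0) (L2Z _ L1).
  have -> : P x s' - P x s - (s' - s) * P1 x s = \int[mu]_z (V x z * D z).
    rewrite /P /P1 -scale// -RintegralB; try exact: L2_integrableM; last by [].
    have j := L2_integrableM xL (L2B L0' L0).
    have j' := L2_integrableM xL (L2Z (s' - s) L1).
    under eq_Rintegral do rewrite -mulrBr.
    rewrite -(RintegralB _ j j')//.
    by apply: eq_Rintegral => z _; rewrite /D /=; ring.
  apply: (le_trans (cauchy_schwarz xL DL)).
  rewrite -mulrA ler_pM ?L2norm_ge0 ?VM//.
  rewrite (_ : C * K * _ = (C * (s' - s) ^+ 2) * K); last by ring.
  have [] // := HK (C * (s' - s) ^+ 2) D; first exact: L2_measurable.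
  move=> z.
  have pos r : s <= r <= s' -> 0 < r by move=> /andP[sr _]; exact: lt_le_trans sr.
  have [|e _] := @taylor2 R (fun r => heat_dipole (heat_rate r) z) (fun r => heat_dipole_t (heat_rate r) z)
    (fun r => heat_dipole_tt (heat_rate r) z) s s'
    (C * ((1 + z ^+ 2) ^+ 3 * expR (- (heat_rate sg ^+ 2 * z ^+ 2)))) ss'
    (fun r rs => is_derive_time_heat_dipole z (pos r rs))
    (fun r rs => is_derive_time_heat_dipole_t z (pos r rs)).
    by move=> r /andP[sr rs']; apply: HCs; [exact: le_trans sr|exact: le_trans s'sg].
  by rewrite mulrAC.
pose g y := P y (sg - y).
have gt : g t = g 0.
  apply: (@quadratic_increments_cst R g 0 t (2 * (M * (C * K)))) => // x y x0 xy yt.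
  have e1 := @step_t (sg - y) x y.
  have e2 := @step_s (sg - y) (sg - x) x.
  have h1 : s0 <= sg - y by rewrite /sg lerBrDr lerD2l.
  have h2 : sg - y <= sg by rewrite gerBl (le_trans x0).
  have h3 : sg - y <= sg - x by rewrite lerD2l lerN2.
  have h4 : sg - x <= sg by rewrite gerBl.
  have {e1} := e1 h1 h2 x0 xy yt.
  have {e2} := e2 h1 h3 h4 x0 (le_trans xy yt).
  rewrite (_ : sg - x - (sg - y) = y - x); last by ring.
  rewrite /g => e2 e1.
  move: e1 e2; move: (P y (sg - y)) (P x (sg - y)) (P x (sg - x)) (P1 x (sg - y)).
  move: (M * (C * K)) => N p q r p1 e1 e2.
  (* The age decreases by as much as the time increases, so the two linear terms are equal and
     cancel; the two quadratic remainders account for the factor 2. *)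
  have -> : p - r = (p - q - (y - x) * p1) - (r - q - (y - x) * p1) by ring.
  apply: (le_trans (ler_normB _ _)).
  by apply: (le_trans (lerD e1 e2)); rewrite -mulrA mulrDl mul1r.
have g0 : g 0 = 0.
  have [L _ _] := hkL _ sg0; rewrite /g subr0.
  exact: pairing_ae0 (VL 0 (lexx 0) t0) L V0.
have gE : g t = P t s0 by congr (P t _); rewrite /sg addrK.
by rewrite -/(P t s0) -gE gt g0.
Qed.

End uniqueness.

(** * Linear span of the Gaussians, and uniqueness of solutions *)

Section gaussian_span.
Context {R : realType}.
Notation mu := (@lebesgue_measure R).

(** In the induction on [q], a factor ['X] becomes [expR (- x ^+ 2)] and raises the exponent from
    [p] to [p + 1]; the claim is therefore proved for all [p >= p0] at once. [A] is abstract because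
    it will be both the orthogonal complement of a null solution and the closure of the reachable
    states. *)
Lemma poly_gaussian_span (A : set (R -> R)) (p0 : R) :
  (forall c f g, A f -> A g -> A (fun x => c * f x + g x)) -> A (cst 0) ->
  (forall p, p0 <= p -> A (xgauss p)) ->
  forall q : {poly R}, A (fun x => x * expR (- (p0 * x ^+ 2)) * q.[expR (- (x ^+ 2))]).
Proof.
move=> Alin A0 AG q.
suff H p : p0 <= p -> A (fun x => x * expR (- (p * x ^+ 2)) * q.[expR (- (x ^+ 2))]).
  exact: H.
elim/poly_ind: q p => [|q c IH] p p0p.
  by rewrite (_ : (fun _ => _) = cst 0)//; apply/funext => x; rewrite horner0 mulr0.
have p1 : p0 <= p + 1 by rewrite (le_trans p0p)// lerDl.
have := Alin c _ _ (AG p p0p) (IH (p + 1) p1).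
congr A; apply/funext => x; rewrite hornerMXaddC /xgauss.
have -> : - ((p + 1) * x ^+ 2) = - (p * x ^+ 2) + - (x ^+ 2) by ring.
by rewrite expRD; ring.
Qed.

(** If [g] is orthogonal to [V t] and within [e] of it, the squared norm of [V t] is its pairing
    with [V t - g], at most [e] times its norm. The exponent 1 is an arbitrary threshold, since
    [null_solution_pairing] holds for every positive age. *)
Lemma null_solution_eq0 (T : R) (V : R -> R -> R) (t : R) : 0 <= T ->
  solution T (cst 0) (cst 0) V -> 0 <= t -> t <= T -> V t = cst 0 %[ae mu].
Proof.
move=> T0 SV t0 tT.
have [HV _ _ _] := SV.
have VH : Htilde0 (V t) by apply: HV; rewrite in_itv/= t0.
have VL := VH.1.
pose A : set (R -> R) := [set f | L2 f /\ \int[mu]_x (V t x * f x) = 0].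
have Alin c f g : A f -> A g -> A (fun x => c * f x + g x).
  move=> [fL f0] [gL g0]; have cfL := L2Z c fL.
  split; first exact: L2D cfL gL.
  under eq_Rintegral do rewrite mulrDr.
  rewrite (RintegralD _ (L2_integrableM VL cfL) (L2_integrableM VL gL))// g0 addr0.
  under eq_Rintegral do rewrite mulrCA.
  by rewrite RintegralZl ?f0 ?mulr0//; exact: L2_integrableM.
have A0 : A (cst 0).
  split; first exact: L2_0.
  by rewrite /Rintegral integral0_eq// => x _; rewrite mulr0.
have AG p : 1 <= p -> A (xgauss p).
  move=> p1; have p0 : 0 < p := lt_le_trans ltr01 p1.
  split; first exact: L2_xgauss.
  (* The age at which the dipole is a multiple of [xgauss p], from
     [heat_rate s ^+ 2 = (4 * s)^-1]. *)
  have s0 : 0 < (4 * p)^-1 by rewrite invr_gt0 mulr_gt0.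
  have := null_solution_pairing T0 SV t0 tT s0.
  have rp : heat_rate (4 * p)^-1 ^+ 2 = p.
    by rewrite heat_rate_sqr//; field; rewrite gt_eqF.
  under eq_Rintegral do rewrite heat_dipoleE rp mulrCA.
  rewrite RintegralZl//; last exact: L2_integrableM VL (L2_xgauss p0).
  move=> /eqP; rewrite mulf_eq0 => /orP[|/eqP//].
  by rewrite gt_eqF// mulr_gt0// exprn_gt0// heat_rate_gt0.
apply: L2norm0_ae => //; apply/eqP; rewrite eq_le L2norm_ge0 andbT.
apply/ler_addgt0Pl => e e0; rewrite addr0.
have [q [gL ge]] := poly_gaussian_density ltr01 e0 VH.
have [_ g0] := poly_gaussian_span Alin A0 AG q.
move: gL ge g0; set g := (fun x => _) => gL ge g0.
have VVg : L2norm (V t) ^+ 2 <= L2norm (V t) * e.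
  apply: (@le_trans _ _ (L2norm (V t) * L2norm (V t \- g))); last first.
    by rewrite ler_wpM2l// L2norm_ge0.
  have := cauchy_schwarz VL (L2B VL gL).
  under eq_Rintegral do rewrite /= mulrBr.
  rewrite (RintegralB _ (L2_integrableM VL VL) (L2_integrableM VL gL))// g0 subr0.
  apply: le_trans; rewrite -lee_fin L2norm_sqr//.
  rewrite (le_trans _ (_ : ((\int[mu]_x (V t x * V t x))%:E <= _)%E))//; last first.
    by rewrite lee_fin ler_norm.
  rewrite /Rintegral fineK; last first.
    by have := integrable_fin_num measurableT (L2_integrableM VL VL); apply.
  by [].
have [->|n0] := eqVneq (L2norm (V t)) 0; first exact: ltW.
have : 0 < L2norm (V t) by rewrite lt_neqAle eq_sym n0 L2norm_ge0.
by move=> n1; rewrite -(ler_pM2l n1) -expr2.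
Qed.

Lemma solution_unique (T : R) (W0 u : R -> R) (W : R -> R -> R) : 0 <= T ->
  solution T W0 u W -> unique_solution T W0 u W.
Proof.
move=> T0 SW; split=> // W' SW' t; rewrite in_itv/= => /andP[t0 tT].
have := solution_lin (-1) T0 SW SW'.
rewrite (_ : (fun x => -1 * W0 x + W0 x) = cst 0); last first.
  by apply/funext => x; rewrite mulN1r addNr.
rewrite (_ : (fun x => -1 * u x + u x) = cst 0); last first.
  by apply/funext => x; rewrite mulN1r addNr.
move=> /null_solution_eq0 => /(_ t T0 t0 tT).
by apply: ae_impl => x /(_ I) /= /eqP; rewrite mulN1r addrC subr_eq0 => /eqP + _.
Qed.

End gaussian_span.

(** * Approximation by reachable states *)

Section reachable_states.
Context {R : realType}.
Notation mu := (@lebesgue_measure R).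

(** Taylor expansion in the duration, pointwise for [x > 0] and then by oddness. The quotient looks
    backward so that both durations stay within [T] even for [s = T]; [h <= s / 2] keeps them above
    [s / 2], where the second time derivative of the tail is uniformly dominated. *)
Lemma heat_odd_taylor (s : R) : 0 < s -> exists2 K : R, 0 <= K &
  forall h, 0 < h -> h <= s / 2 ->
  L2norm (fun x => h^-1 * (heat_odd (heat_rate s) x - heat_odd (heat_rate (s - h)) x)
                   - heat_dipole (heat_rate s) x) <= K * h.
Proof.
move=> s0.
have s2 : 0 < s / 2 by rewrite divr_gt0.
have w10 := heat_rate_gt0 s0.
have w12 : heat_rate s <= heat_rate (s / 2) by apply: heat_rate_le => //; lra.
have [C C0 HC] := heat_dipole_time_bounds w10 w12.
have w02 : 0 < heat_rate s ^+ 2 by rewrite exprn_gt0.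
have [K K0 HK] := L2_gauss_dominated 3 w02.
exists (C * K); first exact: mulr_ge0.
move=> h h0 hs.
set D := (X in L2norm X).
have sh : 0 < s - h by lra.
have hms : s - h <= s by rewrite gerBl ltW.
have DL : measurable_fun setT D.
  apply: measurable_funB; last exact: L2_measurable (L2_heat_dipole w10).
  apply: measurable_funM => //; apply: measurable_funB; exact: measurable_heat_odd.
have heat_dipole_opp x : heat_dipole (heat_rate s) (- x) = - heat_dipole (heat_rate s) x.
  by rewrite !heat_dipoleE /xgauss sqrrN; ring.
have D_opp x : D (- x) = - D x.
  by rewrite /D !heat_odd_opp heat_dipole_opp -!opprD mulrN -opprD.
have Dpos x : 0 < x ->
    `|D x| <= C * h * ((1 + x ^+ 2) ^+ 3 * expR (- (heat_rate s ^+ 2 * x ^+ 2))).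
  move=> x0.
  set E := (1 + x ^+ 2) ^+ 3 * _.
  have heat_dipole_tE r : s - h <= r <= s -> `|heat_dipole_t (heat_rate r) x| <= C * E.
    move=> /andP[hr rs]; have r0 := lt_le_trans sh hr.
    have [] // := HC (heat_rate r) x; first exact: heat_rate_le.
    by apply: heat_rate_le => //; lra.
  have pos r : s - h <= r <= s -> 0 < r by move=> /andP[hr _]; exact: lt_le_trans hr.
  have [_] := @taylor2 R (fun r => heat_tail (heat_rate r) x) (fun r => heat_dipole (heat_rate r) x)
    (fun r => heat_dipole_t (heat_rate r) x) (s - h) s (C * E) hms
    (fun r rs => is_derive_time_heat_tail x (pos r rs))
    (fun r rs => is_derive_time_heat_dipole x (pos r rs)) heat_dipole_tE.
  rewrite (_ : s - (s - h) = h); last by ring.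
  rewrite /D /heat_odd x0 mulrAC => tl.
  have -> : h^-1 * (heat_tail (heat_rate s) x - heat_tail (heat_rate (s - h)) x) -
      heat_dipole (heat_rate s) x =
     h^-1 * (heat_tail (heat_rate s) x - heat_tail (heat_rate (s - h)) x - h * heat_dipole (heat_rate s) x).
    by field; rewrite gt_eqF.
  have hV : 0 <= h^-1 by rewrite invr_ge0 ltW.
  rewrite normrM (ger0_norm hV) ler_pdivrMl//.
  by rewrite (_ : h * (C * h * E) = C * h ^+ 2 * E)//; ring.
have [] // := HK (C * h) D; last by move=> _; rewrite mulrAC.
move=> x; case: (ltgtP x 0) => x0.
- by have := Dpos (- x); rewrite D_opp normrN sqrrN oppr_gt0; apply.
- exact: Dpos.
- rewrite /D /heat_odd x0 ltxx heat_dipoleE /xgauss mul0r mulr0 !subr0 mulr0 normr0.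
  by rewrite expr0n/= addr0 expr1n mul1r (mulr_ge0 (mulr_ge0 C0 (ltW h0)) (expR_ge0 _)).
Qed.

Lemma L2norm_dist_trans (f g h : R -> R) : L2 f -> L2 g -> L2 h ->
  L2norm (f \- h) <= L2norm (f \- g) + L2norm (g \- h).
Proof.
move=> fL gL hL; have := L2normD (L2B fL gL) (L2B gL hL).
by congr (L2norm _ <= _); apply/funext => x /=; rewrite addrA subrK.
Qed.

(** A substitute for the reachable set: everywhere bounded measurable controls, and no demand of
    uniqueness, make it visibly a linear space. [bounded_Linfty] and [solution_unique] lead back to
    [reachable]. *)
Definition bounded_control_state (T : R) : set (R -> R) := [set g |
  exists (u : R -> R) (W : R -> R -> R),
  [/\ measurable_fun setT u, exists M : R, forall t, `|u t| <= M,
      solution T (cst 0) u W & W T = g]].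

Definition L2_closure (A : set (R -> R)) : set (R -> R) := [set f | L2 f /\
  forall e, 0 < e -> exists2 g, A g & L2norm (g \- f) <= e].

Section fixed_time.
Variable T : R.
Hypothesis T0 : 0 < T.
Local Notation S := (bounded_control_state T).

Lemma bounded_control_state_Htilde0 g : S g -> Htilde0 g.
Proof.
move=> [u [W [_ _ [HW _ _ _] <-]]].
by apply: HW; rewrite in_itv/= lexx ltW.
Qed.

Lemma bounded_control_state_L2 g : S g -> L2 g.
Proof. by move=> /bounded_control_state_Htilde0[]. Qed.

Lemma bounded_control_state_lin c f g : S f -> S g -> S (fun x => c * f x + g x).
Proof.
move=> [u [W [mu_ [M uM] SW <-]]] [v [V [mv [N vN] SV <-]]].
exists (fun t => c * u t + v t), (fun t x => c * W t x + V t x); split=> //.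
- by apply: measurable_funD => //; exact: measurable_funM.
- exists (`|c| * M + N) => t.
  by rewrite (le_trans (ler_normD _ _))// lerD// normrM ler_wpM2l.
- have := solution_lin c (ltW T0) SW SV.
  by rewrite (_ : (fun x => c * cst 0 x + cst 0 x) = cst 0)//; apply/funext => x; rewrite mulr0 addr0.
Qed.

Lemma bounded_control_step_state a : 0 <= a -> S (step_state a T).
Proof.
move=> a0; exists (step_control a), (step_state a); split=> //.
- by apply: measurable_fun_ifT => //; exact: measurable_fun_ler.
- exists `|gauss_tail 0| => t; rewrite /step_control.
  by case: ifP => _; rewrite ?normr0.
- exact: step_solution.
Qed.

Lemma bounded_control_cst0 : S (cst 0).
Proof. by have := bounded_control_step_state (ltW T0); rewrite /step_state lexx. Qed.

Lemma bounded_control_heat_odd s : 0 < s -> s <= T -> S (heat_odd (heat_rate s)).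
Proof.
move=> s0 sT; have := @bounded_control_step_state (T - s).
by rewrite subr_ge0 /step_state (leNgt T) gtrBl s0 /= subKr; apply.
Qed.

(** The controls behind the difference quotient are pulses of height [gauss_tail 0 / h] on []T - s,
    T - s + h]], which imitate an impulse at time [T - s]. *)
Lemma closure_heat_dipole s : 0 < s -> s <= T -> L2_closure S (heat_dipole (heat_rate s)).
Proof.
move=> s0 sT; split; first exact: L2_heat_dipole (heat_rate_gt0 s0).
move=> e e0; have [K K0 HK] := heat_odd_taylor s0.
pose h := Num.min (s / 2) (e / (K + 1)).
have K1 : 0 < K + 1 by rewrite ltr_wpDl.
have h0 : 0 < h by rewrite lt_min !divr_gt0.
have hs : h <= s / 2 by rewrite ge_min lexx.
have he : K * h <= e.
  have : h <= e / (K + 1) by rewrite ge_min lexx orbT.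
  rewrite ler_pdivlMr//; apply: le_trans.
  by rewrite mulrC (ler_wpM2l (ltW h0))// lerDl.
exists (fun x => h^-1 * (- 1 * heat_odd (heat_rate (s - h)) x + heat_odd (heat_rate s) x) + cst 0 x).
  apply: bounded_control_state_lin; last exact: bounded_control_cst0.
  apply: bounded_control_state_lin; apply: bounded_control_heat_odd => //; lra.
rewrite (le_trans _ he)//; have := HK h h0 hs.
by congr (L2norm _ <= _); apply/funext => x /=; rewrite addr0 mulN1r [X in h^-1 * X]addrC.
Qed.

Lemma closure_lin c f g : L2_closure S f -> L2_closure S g ->
  L2_closure S (fun x => c * f x + g x).
Proof.
move=> [fL fS] [gL gS]; split; first exact: L2D (L2Z c fL) gL.
move=> e e0; have c1 : 0 < `|c| + 1 by rewrite ltr_wpDl.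
(* Dividing by [|c| + 1] rather than [|c|] also covers [c = 0]. *)
have [|f' f'S fe] := fS (e / 2 / (`|c| + 1)); first by rewrite !divr_gt0.
have [|g' g'S ge] := gS (e / 2); first by rewrite divr_gt0.
exists (fun x => c * f' x + g' x); first exact: bounded_control_state_lin.
have f'L := bounded_control_state_L2 f'S; have g'L := bounded_control_state_L2 g'S.
have -> : (fun x => c * f' x + g' x) \- (fun x => c * f x + g x) =
    (fun x => c * (f' \- f) x) \+ (g' \- g).
  by apply/funext => x /=; ring.
have f'fL := L2B f'L fL; have g'gL := L2B g'L gL.
rewrite (le_trans (L2normD (L2Z c f'fL) g'gL))// L2normZ// [leRHS]splitr lerD//.
rewrite ler_pdivlMr// in fe.
by apply: le_trans fe; rewrite mulrC ler_wpM2l ?L2norm_ge0// lerDl.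
Qed.

Lemma closure_cst0 : L2_closure S (cst 0).
Proof.
split; first exact: L2_0.
move=> e e0; exists (cst 0); first exact: bounded_control_cst0.
apply: L2norm_le; [exact: L2B L2_0 L2_0|exact: ltW|].
by rewrite integral0_eq ?lee_fin ?sqr_ge0// => x _; rewrite /= subr0 expr0n.
Qed.

(** [xgauss p] is a multiple of the dipole of age [(4 * p)^-1], and the condition on [p] says
    precisely that this age is at most [T]. *)
Lemma closure_xgauss p : (4 * T)^-1 <= p -> L2_closure S (xgauss p).
Proof.
move=> Tp; have p0 : 0 < p by rewrite (lt_le_trans _ Tp)// invr_gt0 mulr_gt0.
have s0 : 0 < (4 * p)^-1 by rewrite invr_gt0 mulr_gt0.
have sT : (4 * p)^-1 <= T.
  move: Tp; rewrite -[X in _ <= X]invrK lef_pV2 ?posrE ?invr_gt0 ?mulr_gt0//.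
  by rewrite invfM ler_pdivrMl.
have w0 := heat_rate_gt0 s0.
have rp : heat_rate (4 * p)^-1 ^+ 2 = p.
  by rewrite heat_rate_sqr//; field; rewrite gt_eqF.
have := closure_lin (2 * heat_rate (4 * p)^-1 ^+ 3)^-1 (closure_heat_dipole s0 sT) closure_cst0.
congr (L2_closure S); apply/funext => x; rewrite heat_dipoleE rp addr0 mulKf//.
by rewrite gt_eqF// mulr_gt0// exprn_gt0.
Qed.

End fixed_time.
End reachable_states.

Theorem theorem5p2 (R : realType) (T : R) (T_gt0 : 0 < T)
    (WT : R -> R) (WT_Htilde0 : Htilde0 WT) :
  approximately_reachable T (cst 0) WT.
Proof.
split=> // e e0; have WTL := WT_Htilde0.1.
(* Two errors occur, the distance of [WT] to a polynomial Gaussian and that of the latter to a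
   reachable state; thirds leave room for the strict inequality. *)
have e3 : 0 < e / 3 by rewrite divr_gt0.
have p0 : 0 < (4 * T)^-1 by rewrite invr_gt0 mulr_gt0.
have [q [gL ge]] := poly_gaussian_density p0 e3 WT_Htilde0.
have [_ gS] := poly_gaussian_span (@closure_lin _ T T_gt0) (closure_cst0 T_gt0)
  (@closure_xgauss _ T T_gt0) q.
have [g' g'S g'e] := gS _ e3.
have g'L := bounded_control_state_L2 T_gt0 g'S.
exists g'.
  have g'H := bounded_control_state_Htilde0 T_gt0 g'S.
  split; first exact: g'H.
  move: g'S => [u [W [mu_ [M uM] SW WTE]]].
  exists u; split; first exact: bounded_Linfty mu_ uM.
  exists W; split; first exact: solution_unique (ltW T_gt0) SW.
  by apply: eq_ae => x; rewrite WTE.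
move: gL ge g'e; set g := (fun x => _) => gL ge g'e.
rewrite L2distE// lte_fin.
rewrite (le_lt_trans (L2norm_dist_trans g'L gL WTL))//.
have -> : g \- WT = \- (WT \- g) by apply/funext => x /=; rewrite opprB.
rewrite L2normN; last exact: L2B.
by rewrite (le_lt_trans (lerD g'e ge))//; lra.
Qed.
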